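(* Let $T$ be a complete first order theory with countable signature and models of cardinality $>1$. In the big model $\mathcal N$ of $T^R$, the relation $\perp^{a\omega}$ satisfies full existence and extension for countable sets: (full existence) for all countable $A,B,C\subseteq\mathcal K$ there is $A'\equiv_C A$ with $A'\perp^{a\omega}_C B$; (extension) for all countable $A,B,\hat B,C\subseteq\mathcal K$ with $B\subseteq\hat B$, if $A\perp^{a\omega}_C B$ then there is $A'\equiv_{BC}A$ with $A'\perp^{a\omega}_C\hat B$.
   Context: Fix an uncountable inaccessible cardinal $\upsilon$; small means cardinality $<\upsilon$. $\mathcal M$ is the big model of $T$ (saturated, finite or of cardinality $\upsilon$). $T^R$ (the randomization of $T$) is the complete continuous theory in the two-sorted signature with a sort $\mathbb K$ (random elements) and a sort $\mathbb B$ (events), a function symbol $[\![\varphi(\cdot)]\!]$ of sort $\mathbb K^n\to\mathbb B$ for each first order formula $\varphi$ with $n$ free variables, a $[0,1]$-valued predicate $\mu$ on $\mathbb B$, Boolean operations on $\mathbb B$, and metrics $d_{\mathbb K},d_{\mathbb B}$; its big model $\mathcal N=(\mathcal K,\mathcal E)$ (saturated, cardinality $\upsilon$) is the reduction of a pre-structure $(\mathcal J,\mathcal F)$ of functions $\Omega\to M$ and events over a complete atomless probability space $(\Omega,\mathcal F,\mu)$, with $[\![\psi(\vec a)]\!]=\{\omega:\mathcal M\models\psi(\vec a(\omega))\}$, $\mathcal F$ consisting exactly of such events, the fullness property that for each $\theta(u,\vec v)$ and $\vec b$ some $a$ has $[\![\theta(a,\vec b)]\!]=[\![\exists u\,\theta(u,\vec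 b)]\!]$, $d_{\mathbb K}(a,b)=\mu[\![a\ne b]\!]$, $d_{\mathbb B}(\mathsf B,\mathsf C)=\mu(\mathsf B\triangle\mathsf C)$. Each $\mathbf b\in\mathcal K$ has a fixed representative $b\in\mathcal J$; for $A\subseteq\mathcal K$, $A(\omega)=\{a(\omega):\mathbf a\in A\}$. $A\perp^{a\omega}_C B$ means: for all countable $A'\subseteq A$, $B'\subseteq B$, $C'\subseteq C$ there is a countable $D$ with $C'\subseteq D\subseteq C$ such that the set $\{\omega:\operatorname{acl}^{\mathcal M}(A'(\omega)\cup D(\omega))\cap\operatorname{acl}^{\mathcal M}(B'(\omega)\cup D(\omega))=\operatorname{acl}^{\mathcal M}(D(\omega))\}$ (which belongs to $\mathcal F$) has $\mu$-measure $1$. $A'\equiv_C A$ means $A'$ (enumerated in correspondence with $A$) has the same type over $C$ in $\mathcal N$ as $A$; $BC=B\cup C$. *)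

(* Defs.v *)
From HB Require Import structures.
From mathcomp Require Import all_boot all_order all_algebra.
From mathcomp Require Import all_classical all_reals all_analysis.

Set Implicit Arguments.
Unset Strict Implicit.
Unset Printing Implicit Defensive.

Import Order.TTheory GRing.Theory Num.Theory.
Import numFieldNormedType.Exports.

Local Open Scope classical_set_scope.
Local Open Scope ring_scope.

(** * Tuples of elements, as functions on ['I_n] *)

(* [x] becomes entry 0; the entries of [v] are shifted by one. *)
Definition fcons (X : Type) (n : nat) (x : X) (v : 'I_n -> X) : 'I_n.+1 -> X :=
  fun i => if unlift ord0 i is Some j then v j else x.

Definition fcat (X : Type) (m n : nat) (v : 'I_m -> X) (w : 'I_n -> X) :
    'I_(m + n) -> X :=
  fun i => match fintype.split i with inl j => v j | inr j => w j end.

(** * Cardinals *)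

(* A cardinal is represented by a type of that cardinality; [card_lt A B] is
   |A| < |B|. *)
Definition card_lt (X Y : Type) (A : set X) (B : set Y) : Prop :=
  ~ (B #<= A)%card.

(* Every cardinal below |U| is the cardinal of a subset of [U], so strong limit
   and regularity can be stated through subsets of [U]. *)
Record uncountable_inaccessible (U : Type) : Prop := {
  inacc_uncountable : ~ countable [set: U];
  inacc_strong_limit : forall A : set U, card_lt A [set: U] ->
    card_lt [set B : set U | B `<=` A] [set: U];
  inacc_regular : forall (I : set U) (F : U -> set U),
    card_lt I [set: U] -> (forall i, I i -> card_lt (F i) [set: U]) ->
    card_lt (\bigcup_(i in I) F i) [set: U] }.

(** * First order logic *)

Record signature : Type := Signature {
  func : Type;
  func_ar : func -> nat;
  rel_sym : Type;
  rel_ar : rel_sym -> nat }.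

Definition countable_signature (L : signature) : Prop :=
  countable [set: func L] /\ countable [set: rel_sym L].

Inductive term (L : signature) (n : nat) : Type :=
| TVar : 'I_n -> term L n
| TApp : forall f : func L, ('I_(func_ar f) -> term L n) -> term L n.

(* [formula L n]: formulas with free variables among x_0, ..., x_(n-1).
   [FEx] binds variable 0. *)
Inductive formula (L : signature) : nat -> Type :=
| FEq : forall n, term L n -> term L n -> formula L n
| FRel : forall n (r : rel_sym L), ('I_(rel_ar r) -> term L n) -> formula L n
| FNot : forall n, formula L n -> formula L n
| FAnd : forall n, formula L n -> formula L n -> formula L n
| FEx : forall n, formula L n.+1 -> formula L n.

Record structure (L : signature) : Type := Structure {
  carrier :> Type;
  func_int : forall f : func L, ('I_(func_ar f) -> carrier) -> carrier;
  rel_int : forall r : rel_sym L, ('I_(rel_ar r) -> carrier) -> Prop;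
  carrier_inhabited : inhabited carrier }.

Fixpoint teval (L : signature) (M : structure L) (n : nat) (v : 'I_n -> M)
    (t : term L n) : M :=
  match t with
  | TVar i => v i
  | TApp f ts => func_int (fun i => teval v (ts i))
  end.

Fixpoint sat (L : signature) (M : structure L) (n : nat) (p : formula L n) :
    ('I_n -> M) -> Prop :=
  match p in formula _ k return ('I_k -> M) -> Prop with
  | FEq _ s t => fun v => teval v s = teval v t
  | FRel _ r ts => fun v => rel_int (fun i => teval v (ts i))
  | FNot _ p => fun v => ~ sat p v
  | FAnd _ p q => fun v => sat p v /\ sat q v
  | FEx _ p => fun v => exists x : M, sat p (fcons x v)
  end.

Definition no_args (X : Type) : 'I_0 -> X :=
  fun i => False_rect X (notF (ltn_ord i)).

Definition sentence (L : signature) : Type := formula L 0.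

Definition models (L : signature) (M : structure L) (T : set (sentence L)) :
    Prop :=
  forall p, T p -> sat p (@no_args M).

Definition entails (L : signature) (T : set (sentence L)) (p : sentence L) :
    Prop :=
  forall M : structure L, models M T -> sat p (@no_args M).

Definition complete_theory (L : signature) (T : set (sentence L)) : Prop :=
  (exists M : structure L, models M T) /\
  (forall p : sentence L, entails T p \/ entails T (FNot p)).

Record param_formula (L : signature) (M : structure L) (n : nat) : Type :=
  ParamFormula {
    pf_arity : nat;
    pf_formula : formula L (n + pf_arity);
    pf_param : 'I_pf_arity -> M }.

Definition pf_sat (L : signature) (M : structure L) (n : nat)
    (p : param_formula M n) (v : 'I_n -> M) : Prop :=
  sat (pf_formula p) (fcat v (@pf_param _ _ _ p)).

Definition saturated (L : signature) (M : structure L) : Prop :=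
  forall A : set M, card_lt A [set: M] ->
  forall (n : nat) (G : set (param_formula M n)),
    (forall p, G p -> forall i, A (@pf_param _ _ _ p i)) ->
    (forall G0 : set (param_formula M n), finite_set G0 -> G0 `<=` G ->
       exists v, forall p, G0 p -> pf_sat p v) ->
    exists v, forall p, G p -> pf_sat p v.

Definition big_model (L : signature) (U : Type) (T : set (sentence L))
    (M : structure L) : Prop :=
  [/\ models M T, saturated M
    & finite_set [set: M] \/ ([set: M] #= [set: U])%card].

Definition acl (L : signature) (M : structure L) (X : set M) : set M :=
  [set m | exists (n : nat) (p : formula L n.+1) (b : 'I_n -> M),
     [/\ forall i, X (b i), finite_set [set x | sat p (fcons x b)]
       & sat p (fcons m b)]].

(** * Continuous logic in the two-sorted randomization signature *)

Definition unit_cube (R : realType) (n : nat) : set 'rV[R]_n :=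
  [set v | forall i, 0 <= v ord0 i <= 1].

Record connective (R : realType) (n : nat) : Type := Connective {
  conn_fun :> 'rV[R]_n -> R;
  conn_continuous : {within @unit_cube R n, continuous conn_fun};
  conn_unit : forall v, unit_cube v -> 0 <= conn_fun v <= 1 }.

(* In [bterm L k e] and [cformula R L k e] there are [k] free variables of the
   random element sort and [e] free variables of the event sort.  The former
   sort has no function symbols into it, so its terms are variables. *)
Inductive bterm (L : signature) (k e : nat) : Type :=
| BVar : 'I_e -> bterm L k e
| BEvent : forall n, formula L n -> ('I_n -> 'I_k) -> bterm L k e
| BTop : bterm L k e
| BBot : bterm L k e
| BMeet : bterm L k e -> bterm L k e -> bterm L k e
| BJoin : bterm L k e -> bterm L k e -> bterm L k e
| BCompl : bterm L k e -> bterm L k e.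

Inductive cformula (R : realType) (L : signature) : nat -> nat -> Type :=
| CDistK : forall k e, 'I_k -> 'I_k -> cformula R L k e
| CDistB : forall k e, bterm L k e -> bterm L k e -> cformula R L k e
| CMu : forall k e, bterm L k e -> cformula R L k e
| CConn : forall k e n (u : connective R n),
    ('I_n -> cformula R L k e) -> cformula R L k e
| CSupK : forall k e, cformula R L k.+1 e -> cformula R L k e
| CInfK : forall k e, cformula R L k.+1 e -> cformula R L k e
| CSupB : forall k e, cformula R L k e.+1 -> cformula R L k e
| CInfB : forall k e, cformula R L k e.+1 -> cformula R L k e.

Record prestructure (R : realType) (L : signature) : Type := PreStructure {
  sortK : Type;
  sortB : Type;
  distK : sortK -> sortK -> R;
  distB : sortB -> sortB -> R;
  evK : forall n, formula L n -> ('I_n -> sortK) -> sortB;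
  muB : sortB -> R;
  topB : sortB;
  botB : sortB;
  meetB : sortB -> sortB -> sortB;
  joinB : sortB -> sortB -> sortB;
  complB : sortB -> sortB }.

Fixpoint beval (R : realType) (L : signature) (N : prestructure R L)
    (k e : nat) (x : 'I_k -> sortK N) (y : 'I_e -> sortB N)
    (t : bterm L k e) : sortB N :=
  match t with
  | BVar i => y i
  | BEvent n p s => evK p (fun i => x (s i))
  | BTop => topB N
  | BBot => botB N
  | BMeet s t => meetB (beval x y s) (beval x y t)
  | BJoin s t => joinB (beval x y s) (beval x y t)
  | BCompl s => complB (beval x y s)
  end.

Fixpoint ceval (R : realType) (L : signature) (N : prestructure R L)
    (k e : nat) (p : cformula R L k e) :
    ('I_k -> sortK N) -> ('I_e -> sortB N) -> R :=
  match p in cformula _ _ k e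
    return ('I_k -> sortK N) -> ('I_e -> sortB N) -> R with
  | CDistK _ _ i j => fun x y => distK (x i) (x j)
  | CDistB _ _ s t => fun x y => distB (beval x y s) (beval x y t)
  | CMu _ _ t => fun x y => muB (beval x y t)
  | CConn _ _ _ u ps => fun x y => u (\row_i ceval (ps i) x y)
  | CSupK _ _ p => fun x y => sup [set ceval p (fcons a x) y | a in setT]
  | CInfK _ _ p => fun x y => inf [set ceval p (fcons a x) y | a in setT]
  | CSupB _ _ p => fun x y => sup [set ceval p x (fcons b y) | b in setT]
  | CInfB _ _ p => fun x y => inf [set ceval p x (fcons b y) | b in setT]
  end.

(* A set of closed formulas stands for the set of conditions "p = 0". *)
Definition cmodels (R : realType) (L : signature) (N : prestructure R L)
    (T : set (cformula R L 0 0)) : Prop :=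
  forall p, T p -> ceval p (@no_args (sortK N)) (@no_args (sortB N)) = 0.

Definition complete_metric (R : realType) (X : Type) (dist : X -> X -> R) :
    Prop :=
  [/\ forall x y, dist x y = 0 <-> x = y,
      forall x y, dist x y = dist y x,
      forall x y z, dist x z <= dist x y + dist y z
    & forall u : nat -> X,
        (forall eps, 0 < eps -> exists n0, forall m n,
           (n0 <= m)%N -> (n0 <= n)%N -> dist (u m) (u n) < eps) ->
        exists l, forall eps, 0 < eps -> exists n0, forall n,
           (n0 <= n)%N -> dist (u n) l < eps].

(* The remaining requirements on a metric structure (distances at most 1,
   uniform continuity of the symbols) are not repeated: they hold in every
   reduction of a neat randomization, where each symbol is 1-Lipschitz in each
   argument. *)
Definition metric_structure (R : realType) (L : signature)
    (N : prestructure R L) : Prop :=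
  complete_metric (@distK R L N) /\ complete_metric (@distB R L N).

Record param_cformula (R : realType) (L : signature) (N : prestructure R L)
    (k e : nat) : Type := ParamCFormula {
  pc_arityK : nat;
  pc_arityB : nat;
  pc_formula : cformula R L (k + pc_arityK)%N (e + pc_arityB)%N;
  pc_paramK : 'I_pc_arityK -> sortK N;
  pc_paramB : 'I_pc_arityB -> sortB N }.

Definition pc_sat (R : realType) (L : signature) (N : prestructure R L)
    (k e : nat) (p : param_cformula N k e)
    (x : 'I_k -> sortK N) (y : 'I_e -> sortB N) : Prop :=
  ceval (pc_formula p) (fcat x (@pc_paramK _ _ _ _ _ p))
    (fcat y (@pc_paramB _ _ _ _ _ p)) = 0.

(* Parameter sets are subsets of the disjoint union of the two sorts. *)
Definition csaturated (R : realType) (L : signature) (N : prestructure R L) :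
    Prop :=
  forall A : set (sortK N + sortB N)%type,
  card_lt A [set: (sortK N + sortB N)%type] ->
  forall (k e : nat) (G : set (param_cformula N k e)),
    (forall p, G p -> (forall i, A (inl (@pc_paramK _ _ _ _ _ p i))) /\
                      (forall i, A (inr (@pc_paramB _ _ _ _ _ p i)))) ->
    (forall G0 : set (param_cformula N k e), finite_set G0 -> G0 `<=` G ->
       exists x y, forall p, G0 p -> pc_sat p x y) ->
    exists x y, forall p, G p -> pc_sat p x y.

(** * Randomizations *)

(* The event [[p(a)]]. *)
Definition event (L : signature) (M : structure L) (Om : Type) (n : nat)
    (p : formula L n) (a : 'I_n -> Om -> M) : set Om :=
  [set w | sat p (fun i => a i w)].

Definition atomless (R : realType) (d : measure_display)
    (Om : measurableType d) (P : probability Om R) : Prop :=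
  forall B : set Om, measurable B -> (0 < P B)%E ->
    exists C : set Om, [/\ measurable C, C `<=` B & (0 < P C < P B)%E].

(* The events are all the measurable sets of [Om]. *)
Record neat_randomization (L : signature) (M : structure L) (R : realType)
    (d : measure_display) (Om : measurableType d) (P : probability Om R)
    (J : set (Om -> M)) : Prop := {
  neat_complete : measure_is_complete P;
  neat_atomless : atomless P;
  neat_event : forall n (p : formula L n) (a : 'I_n -> Om -> M),
    (forall i, J (a i)) -> measurable (event p a);
  neat_event_onto : forall B : set Om, measurable B ->
    exists n (p : formula L n) (a : 'I_n -> Om -> M),
      (forall i, J (a i)) /\ B = event p a;
  neat_full : forall n (p : formula L n.+1) (b : 'I_n -> Om -> M),
    (forall i, J (b i)) ->
    exists2 a, J a & event p (fcons a b) = event (FEx p) b }.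

Definition randomization (L : signature) (M : structure L) (R : realType)
    (d : measure_display) (Om : measurableType d) (P : probability Om R)
    (J : set (Om -> M)) (HJ : neat_randomization P J) : prestructure R L :=
  @PreStructure R L {a : Om -> M | J a} {B : set Om | measurable B}
    (fun a b => fine (P [set w | sval a w <> sval b w]))
    (fun B C => fine (P ((sval B `\` sval C) `|` (sval C `\` sval B))))
    (fun n p a => exist _ (event p (fun i => sval (a i)))
                    (neat_event HJ p (fun i => svalP (a i))))
    (fun B => fine (P (sval B)))
    (exist _ setT measurableT)
    (exist _ set0 measurable0)
    (fun B C => exist _ (sval B `&` sval C)
                  (measurableI _ _ (svalP B) (svalP C)))
    (fun B C => exist _ (sval B `|` sval C)
                  (measurableU _ _ (svalP B) (svalP C)))
    (fun B => exist _ (~` sval B) (measurableC (svalP B))).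

(* The theory T^R: the conditions true in all neat randomizations of models
   of T. *)
Definition randomization_theory (R : realType) (L : signature)
    (T : set (sentence L)) : set (cformula R L 0 0) :=
  [set p | forall (M : structure L) (d : measure_display)
      (Om : measurableType d) (P : probability Om R) (J : set (Om -> M))
      (HJ : neat_randomization P J),
      models M T ->
      ceval (N := randomization HJ) p (@no_args _) (@no_args _) = 0].

(* [N] is a quotient of the pre-structure [Q].  When [N] is a metric structure,
   [distK]-preservation makes [redK] identify exactly the elements at distance
   0, and likewise for [redB]. *)
Record reduction (R : realType) (L : signature) (Q N : prestructure R L) :
    Type := Reduction {
  redK : sortK Q -> sortK N;
  redB : sortB Q -> sortB N;
  redK_surj : forall x, exists a, redK a = x;
  redB_surj : forall y, exists B, redB B = y;
  red_distK : forall a b, distK (redK a) (redK b) = distK a b;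
  red_distB : forall B C, distB (redB B) (redB C) = distB B C;
  red_ev : forall n (p : formula L n) (a : 'I_n -> sortK Q),
    evK p (fun i => redK (a i)) = redB (evK p a);
  red_mu : forall B, muB (redB B) = muB B;
  red_top : topB N = redB (topB Q);
  red_bot : botB N = redB (botB Q);
  red_meet : forall B C, meetB (redB B) (redB C) = redB (meetB B C);
  red_join : forall B C, joinB (redB B) (redB C) = redB (joinB B C);
  red_compl : forall B, complB (redB B) = redB (complB B) }.

Definition big_model_of_randomization (R : realType) (L : signature)
    (U : Type) (T : set (sentence L)) (N : prestructure R L) : Prop :=
  [/\ metric_structure N, cmodels N (randomization_theory T), csaturated N
    & ([set: (sortK N + sortB N)%type] #= [set: U])%card].

(** * Types and pointwise independence in a randomization *)

(* [A'] is [A] re-enumerated by [f], with the same type over [C]. *)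
Definition same_type_over (R : realType) (L : signature)
    (N : prestructure R L) (C A' A : set (sortK N)) : Prop :=
  exists2 f : sortK N -> sortK N, A' = f @` A &
    forall (m n : nat) (p : cformula R L (m + n)%N 0)
      (a : 'I_m -> sortK N) (c : 'I_n -> sortK N),
      (forall i, A (a i)) -> (forall i, C (c i)) ->
      ceval p (fcat (fun i => f (a i)) c) (@no_args _) =
      ceval p (fcat a c) (@no_args _).

(* [A(w)], for a choice [rep] of representatives. *)
Definition pointwise (L : signature) (M : structure L) (Om K : Type)
    (rep : K -> Om -> M) (A : set K) (w : Om) : set M :=
  [set rep a w | a in A].

Definition aomega_indep (L : signature) (M : structure L) (R : realType)
    (d : measure_display) (Om : measurableType d) (P : probability Om R)
    (K : Type) (rep : K -> Om -> M) (A C B : set K) : Prop :=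
  forall A' B' C' : set K,
    countable A' -> countable B' -> countable C' ->
    A' `<=` A -> B' `<=` B -> C' `<=` C ->
    exists D : set K, [/\ countable D, C' `<=` D, D `<=` C &
      let E := [set w |
        acl (pointwise rep A' w `|` pointwise rep D w) `&`
        acl (pointwise rep B' w `|` pointwise rep D w) =
        acl (pointwise rep D w)] in
      measurable E /\ P E = 1%E].

(* Main.v *)
(* Call a countable set of pairs of random elements elementary when, for every
   first order formula, the two sides give the same event.  Then at almost every
   w the values of the pairs form a partial elementary map of M, and a back and
   forth argument shows that the two sides have the same type in N.

   Given such a set X, a random element a and a countable set G of functions,
   saturation of N gives v such that X + (a, v) is elementary and almost surely
   acl(X_2 v) meets G inside acl(X_2), where X_2 is the set of second entries:
   the event "g is algebraic over X_2" is measurable, hence definable with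
   parameters in J, so these requirements are conditions over countably many
   parameters.  By fullness a finite set of them is satisfiable as soon as it is
   at almost every w, which is the pure first order lemma [free_extension].

   Iterating along an enumeration of A, from the identity on C and with G
   covering acl(BC), yields full existence.  Extension follows from full
   existence over BC, because independence from B over C is preserved by partial
   elementary maps. *)
From Stdlib Require List.
Require Import Defs.
From mathcomp Require Import all_boot all_order all_algebra.
From mathcomp Require Import all_classical all_reals all_analysis.
Local Open Scope classical_set_scope.
Set Implicit Arguments.
Unset Strict Implicit.
Unset Printing Implicit Defensive.

(** * Definable relations with parameters *)

Lemma fcons0 (X : Type) n (x : X) (v : 'I_n -> X) : fcons x v ord0 = x.
Proof. by rewrite /fcons unlift_none. Qed.

Lemma fconsS (X : Type) n (x : X) (v : 'I_n -> X) i :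
  fcons x v (lift ord0 i) = v i.
Proof. by rewrite /fcons liftK. Qed.

Lemma fcons_comp (X Y : Type) n (h : X -> Y) (x : X) (v : 'I_n -> X) i :
  h (fcons x v i) = fcons (h x) (fun j => h (v j)) i.
Proof. by rewrite /fcons; case: unlift. Qed.

Lemma fcatl (X : Type) m n (v : 'I_m -> X) (w : 'I_n -> X) i :
  fcat v w (lshift n i) = v i.
Proof. by rewrite /fcat -[lshift n i]/(unsplit (inl i)) unsplitK. Qed.

Lemma fcatr (X : Type) m n (v : 'I_m -> X) (w : 'I_n -> X) i :
  fcat v w (rshift m i) = w i.
Proof. by rewrite /fcat -[rshift m i]/(unsplit (inr i)) unsplitK. Qed.

Lemma fcat1 (X : Type) n (v : 'I_1 -> X) (w : 'I_n -> X) :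
  fcat v w = fcons (v ord0) w :> ('I_(n.+1) -> X).
Proof.
apply: funext => i; case: (unliftP ord0 i) => [j|] ->.
  rewrite fconsS; have -> : lift ord0 j = rshift 1 j by exact: val_inj.
  by rewrite fcatr.
rewrite fcons0; have -> : ord0 = lshift n (ord0 : 'I_1) by exact: val_inj.
by rewrite fcatl.
Qed.

Section Renaming.
Variable L : signature.

Fixpoint tren n k (s : 'I_n -> 'I_k) (t : term L n) : term L k :=
  match t with
  | TVar i => TVar L (s i)
  | TApp f ts => TApp (fun i => tren s (ts i))
  end.

Fixpoint fren n (p : formula L n) : forall k, ('I_n -> 'I_k) -> formula L k :=
  match p in formula _ n return forall k, ('I_n -> 'I_k) -> formula L k with
  | FEq _ t u => fun k s => FEq (tren s t) (tren s u)
  | FRel _ r ts => fun k s => FRel (fun i => tren s (ts i))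
  | FNot _ p => fun k s => FNot (fren p s)
  | FAnd _ p q => fun k s => FAnd (fren p s) (fren q s)
  | FEx _ p => fun k s =>
      FEx (fren p (fcons ord0 (fun j => lift ord0 (s j))))
  end.

Variable M : structure L.

Lemma teval_ren n k (s : 'I_n -> 'I_k) (t : term L n) (v : 'I_k -> M) :
  teval v (tren s t) = teval (fun i => v (s i)) t.
Proof.
elim: t => [//|f ts IH] /=.
by congr (func_int _); apply: funext => i; exact: IH.
Qed.

Lemma sat_ren n (p : formula L n) k (s : 'I_n -> 'I_k) (v : 'I_k -> M) :
  sat (fren p s) v <-> sat p (fun i => v (s i)).
Proof.
elim: p k s v => {n} /= [n t u|n r ts|n p IH|n p IH q IH'|n p IH] k s v.
- by rewrite !teval_ren.
- by under [X in rel_int X]eq_fun do rewrite teval_ren.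
- by rewrite IH.
- by rewrite IH IH'.
- have E x : (fun i => fcons x v (fcons ord0 (fun j => lift ord0 (s j)) i)) =
             fcons x (fun i => v (s i)).
    apply: funext => i; case: (unliftP ord0 i) => [j|] ->.
      by rewrite !fconsS.
    by rewrite !fcons0.
  by split=> -[x H]; exists x; move: H; rewrite IH E.
Qed.

End Renaming.

Definition scons (X : Type) (x : X) (v : nat -> X) : nat -> X :=
  fun i => if i is j.+1 then v j else x.

(* Definable relations between an environment [v] of variables and an index
   [w : W]; the parameters are functions of [w].  With [W] a probability space
   they are random elements, and with [W = bool] they are the pairs of a
   partial map of [M]. *)
Inductive slot (W X : Type) : Type := SVar of nat | SPar of (W -> X).
Arguments SVar {W X}.

Definition slot_val (W X : Type) (s : slot W X) (v : nat -> X) (w : W) : X :=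
  match s with SVar i => v i | SPar x => x w end.

Definition slot_in (W X : Type) (A : set (W -> X)) (s : slot W X) : Prop :=
  if s is SPar x then A x else True.

(** The formula and the slots are fixed for all indices; only the parameter values depend on [w].
    This uniformity yields measurability over a probability space and transfer between the two sides
    of a partial map. *)
Definition gdef (L : signature) (M : structure L) (W : Type)
    (A : set (W -> M)) (D : (nat -> M) -> W -> Prop) : Prop :=
  exists m (p : formula L m) (ts : 'I_m -> slot W M),
    (forall i, slot_in A (ts i)) /\
    forall v w, D v w <-> sat p (fun i => slot_val (ts i) v w).

Section Gdef.
Variables (L : signature) (M : structure L) (W : Type) (A : set (W -> M)).
Implicit Type D : (nat -> M) -> W -> Prop.

Lemma gdef_ext D D' : (forall v w, D v w <-> D' v w) -> gdef A D -> gdef A D'.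
Proof.
by move=> E [m [p [ts [h H]]]]; exists m, p, ts; split=> // v w; rewrite -E.
Qed.

Lemma gdef_not D : gdef A D -> gdef A (fun v w => ~ D v w).
Proof.
by move=> [m [p [ts [h H]]]]; exists m, (FNot p), ts; split=> // v w /=;
  rewrite H.
Qed.

Lemma gdef_and D D' :
  gdef A D -> gdef A D' -> gdef A (fun v w => D v w /\ D' v w).
Proof.
move=> [m [p [ts [h H]]]] [m' [p' [ts' [h' H']]]].
exists (m + m')%N, (FAnd (fren p (@lshift m m')) (fren p' (@rshift m m'))).
exists (fcat ts ts'); split.
  by move=> i; rewrite /fcat; case: fintype.split.
move=> v w /=; rewrite !sat_ren H H'.
have -> : (fun i => slot_val (fcat ts ts' (lshift m' i)) v w) =
          (fun i => slot_val (ts i) v w) by apply: funext => i; rewrite fcatl.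
have -> // : (fun i => slot_val (fcat ts ts' (rshift m i)) v w) =
          (fun i => slot_val (ts' i) v w) by apply: funext => i; rewrite fcatr.
Qed.

Lemma gdef_imp D D' :
  gdef A D -> gdef A D' -> gdef A (fun v w => D v w -> D' v w).
Proof.
move=> h h'; apply: (@gdef_ext (fun v w => ~ (D v w /\ ~ D' v w))).
  by move=> v w; split=> [H d|H [d]]; [apply: contrapT => d'; exact: H|apply;
    exact: H].
by apply: gdef_not; apply: gdef_and => //; exact: gdef_not.
Qed.

Lemma gdef_or D D' :
  gdef A D -> gdef A D' -> gdef A (fun v w => D v w \/ D' v w).
Proof.
move=> h h'; apply: (@gdef_ext (fun v w => ~ D v w -> D' v w)).
  by move=> v w; split=> [H|[//|//]]; case: (pselect (D v w)); [left|right;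
    exact: H].
by apply: gdef_imp => //; exact: gdef_not.
Qed.

Lemma gdef_iff D D' :
  gdef A D -> gdef A D' -> gdef A (fun v w => D v w <-> D' v w).
Proof. by move=> h h'; apply: gdef_and; exact: gdef_imp. Qed.

Lemma gdef_ex D : gdef A D -> gdef A (fun v w => exists x, D (scons x v) w).
Proof.
move=> [m [p [ts [h H]]]].
(* Positions holding [SVar 0] are renamed to the bound variable, and the other variables drop by
   one. The slot left at a renamed position is never read. *)
exists m, (FEx (fren p (fun i =>
  if ts i is SVar 0 then ord0 else lift ord0 i))).
exists (fun i => if ts i is SVar j.+1 then SVar j else ts i); split.
  by move=> i; have := h i; case: (ts i) => // -[].
move=> v w; have E x : D (scons x v) w <-> sat
    (fren p (fun i => if ts i is SVar 0 then ord0 else lift ord0 i))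
    (fcons x (fun i =>
      slot_val (if ts i is SVar j.+1 then SVar j else ts i) v w)).
  rewrite sat_ren H; set f := fun i => _; set g := fun i => _.
  suff -> : f = g by [].
  apply: funext => i; rewrite /f /g.
  by case e : (ts i) => [[|j]|y]; rewrite ?fcons0 ?fconsS ?e.
by split=> -[x /E Hx]; exists x.
Qed.

Lemma gdef_all D : gdef A D -> gdef A (fun v w => forall x, D (scons x v) w).
Proof.
move=> h; apply: (@gdef_ext (fun v w => ~ exists x, ~ D (scons x v) w)).
  move=> v w; split=> [H x|H [x]]; last by apply.
  by apply: contrapT => Hx; apply: H; exists x.
by apply: gdef_not; apply: (@gdef_ex (fun v w => ~ D v w)); exact: gdef_not.
Qed.

Lemma gdef_subst D (ts : nat -> slot W M) :
  gdef A D -> (forall i, slot_in A (ts i)) ->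
  gdef A (fun v w => D (fun i => slot_val (ts i) v w) w).
Proof.
move=> [m [p [us [h H]]]] h'.
exists m, p, (fun i => if us i is SVar j then ts j else us i); split.
  by move=> i; have := h i; case: (us i) => // j _; exact: h'.
move=> v w; rewrite H; set f := fun i => _; set g := fun i => _.
by suff -> : f = g by []; apply: funext => i; rewrite /f /g; case: (us i).
Qed.

Lemma gdef_eq (s t : slot W M) : slot_in A s -> slot_in A t ->
  gdef A (fun v w => slot_val s v w = slot_val t v w).
Proof.
move=> hs ht.
exists 2%N, (FEq (TVar L ord0) (TVar L (lift ord0 ord0))).
exists (fcons s (fun=> t)); split.
  by move=> i; rewrite /fcons; case: unlift.
by move=> v w /=; rewrite fcons0 fconsS.
Qed.

Lemma gdef_const (Q : Prop) : gdef A (fun _ _ => Q).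
Proof.
have h : gdef A (fun v _ => v 0 = v 0).
  exact: (@gdef_eq (SVar 0) (SVar 0)).
case: (pselect Q) => q; first exact: gdef_ext h.
apply: gdef_ext (gdef_not h) => v w; split=> // H; case: (H erefl).
Qed.

(* One variable is plugged in everywhere, so that spurious variables of [D] do
   not matter. *)
Lemma gdef_normal D : gdef A D ->
  exists m (p : formula L m.+1) (b : 'I_m -> W -> M), (forall i, A (b i)) /\
    forall x w, D (fun=> x) w <-> sat p (fcons x (fun i => b i w)).
Proof.
move=> [m [p [ts [h H]]]].
(* By induction on the number of slots, variables collapse to position 0 and parameters are
   collected in [b]. *)
have: exists n (s : 'I_m -> 'I_n.+1) (b : 'I_n -> W -> M),
    (forall i, A (b i)) /\
    forall x w i, slot_val (ts i) (fun=> x) w = fcons x (fun j => b j w) (s i).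
  elim: m ts h {p H} => [ts _|m IH ts h].
    by exists 0%N, (fun=> ord0), (@no_args _); split=> [[]|? ? []].
  have [//|n [s [b [hb E]]]] := IH (fun i => ts (lift ord0 i)).
  have := h ord0; case e : (ts ord0) => [j|y] hy.
    exists n, (fcons ord0 s), b; split=> // x w i.
    case: (unliftP ord0 i) => [j'|] ->; first by rewrite E fconsS.
    by rewrite e /= !fcons0.
  exists n.+1, (fcons (lift ord0 ord0) (fun i => fcons ord0 (fun j =>
    lift ord0 (lift ord0 j)) (s i))).
  exists (fcons y b); split.
    by move=> i; rewrite /fcons; case: unlift.
  move=> x w i; case: (unliftP ord0 i) => [j'|] ->; last first.
    by rewrite e /= fcons0 fconsS fcons0.
  rewrite E fconsS; case: (unliftP ord0 (s j')) => [k|] ->;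
    last by rewrite !fcons0.
  by rewrite !fconsS.
move=> [n [s [b [hb E]]]]; exists n, (fren p s), b; split=> // x w.
rewrite sat_ren H; set f := fun i => _; set g := fun i => _.
by suff -> : f = g by []; apply: funext => i; exact: E.
Qed.

End Gdef.

Lemma gdef_sub (L : signature) (M : structure L) W (A B : set (W -> M)) D :
  A `<=` B -> gdef A D -> gdef B D.
Proof.
move=> AB [m [p [ts [h H]]]]; exists m, p, ts; split=> // i.
by have := h i; case: (ts i) => //= x /AB.
Qed.

(** * Finite definable sets and algebraic closure *)

(** Cardinality at most [k], whose recursion on [k] in [lecS] is first order. *)
Definition lec (X : Type) (k : nat) (E : X -> Prop) : Prop :=
  exists l : seq X, (size l <= k)%N /\ forall x, E x -> List.In x l.

Section Counting.
Variable X : Type.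
Implicit Types E : X -> Prop.

Lemma lec_sub k E E' : (forall x, E x -> E' x) -> lec k E' -> lec k E.
Proof. by move=> EE' [l [sl hl]]; exists l; split=> // x /EE' /hl. Qed.

Lemma lecU k k' E E' :
  lec k E -> lec k' E' -> lec (k + k') (fun x => E x \/ E' x).
Proof.
move=> [l [sl hl]] [l' [sl' hl']]; exists (l ++ l'); split.
  by rewrite size_cat leq_add.
by move=> x H; apply/List.in_app_iff; case: H => [/hl|/hl']; [left|right].
Qed.

Lemma lec0 E : lec 0 E <-> forall x, ~ E x.
Proof.
split=> [[[|z l] [sl h]] x Ex|h] //; first exact: (h x).
by exists [::]; split=> // x /h.
Qed.

Lemma lecS k E : lec k.+1 E <-> forall x, E x -> lec k (fun y => E y /\ y <> x).
Proof.
split=> [[l [sl hl]] x Ex|h].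
  have [l1 [l2 e]] := List.in_split _ _ (hl _ Ex).
  exists (l1 ++ l2); split.
    by move: sl; rewrite e !size_cat /= addnS ltnS.
  move=> y [/hl]; rewrite e => Hy yx; apply/List.in_app_iff.
  have /List.in_app_iff[?|[/esym//|?]] := Hy; first by left.
  by right.
case: (pselect (exists x, E x)) => [[x Ex]|n]; last first.
  by exists [::]; split=> // x Ex; case: n; exists x.
have [l [sl hl]] := h x Ex; exists (x :: l); split=> // y Ey /=.
by case: (pselect (y = x)) => [->|n]; [left|right; exact: hl].
Qed.

Lemma lec_finite k E : lec k E -> finite_set [set x | E x].
Proof.
elim: k E => [|k IH] E.
  by move=> /lec0 h; suff -> : [set x | E x] = set0 by []; apply/seteqP; split.
move=> /lecS h; case: (pselect (exists x, E x)) => [[x Ex]|n]; last first.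
  suff -> : [set x | E x] = set0 by [].
  by apply/seteqP; split=> // x Ex; case: n; exists x.
apply: (@sub_finite_set _ _ ([set x] `|` [set y | E y /\ y <> x])).
  by move=> y /= Ey; case: (pselect (y = x)) => [->|n]; [left|right].
by rewrite finite_setU; split; [exact: finite_set1|exact: IH (h x Ex)].
Qed.

Lemma finite_lec E : finite_set [set x | E x] -> exists k, lec k E.
Proof.
move=> [n]; elim: n E => [|n IH] E h.
  exists 0%N; apply/lec0 => x Ex.
  by move: h; rewrite II0 card_eq0 => /eqP e; have : set0 x by rewrite -e.
have /eq_cardSP[x Ex h'] := h.
have [k [l [sl hl]]] := IH (fun y => E y /\ y <> x) h'.
exists k.+1, (x :: l); split=> // y Ey /=.
by case: (pselect (y = x)) => [->|e]; [left|right; exact: hl].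
Qed.

End Counting.

Lemma acl_mono (L : signature) (M : structure L) (X Y : set M) :
  X `<=` Y -> acl X `<=` acl Y.
Proof.
by move=> XY y [n [p [b [hb fin sy]]]]; exists n, p, b; split=> // i; exact: XY.
Qed.

(** [F y a] is read as: the point [y] lies in the set with index [a]. Then [t] points, possibly
    repeated, meet every set with index in [alpha]; discarding the indices already met keeps the
    notion first order. *)
Fixpoint transv (X : Type) (F : X -> X -> Prop) (t : nat)
    (alpha : X -> Prop) : Prop :=
  match t with
  | 0 => forall a, ~ alpha a
  | t.+1 => exists y, transv F t (fun a => alpha a /\ ~ F y a)
  end.

Definition side (W X : Type) (w : W) (A : set (W -> X)) : set X :=
  [set x w | x in A].

Section DefinableAcl.
Variables (L : signature) (M : structure L) (W : Type) (A : set (W -> M)).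

Definition def1 (E : M -> W -> Prop) : Prop := gdef A (fun v w => E (v 0%N) w).

Lemma def1_acl (E : M -> W -> Prop) w y : def1 E ->
  finite_set [set x | E x w] -> E y w -> acl (side w A) y.
Proof.
move=> /gdef_normal[m [p [b [hb H]]]] fin Ey.
exists m, p, (fun i => b i w); split=> [i||]; last exact/H.
  by exists (b i).
apply: sub_finite_set fin => x /= hx; exact/H.
Qed.

(** Each parameter at [w] is lifted to an element of [A] with that value, which turns a formula at
    one index into a family over all indices. Finiteness is asserted at [w] only. *)
Lemma acl_def1 w y : acl (side w A) y ->
  exists E, [/\ def1 E, finite_set [set x | E x w] & E y w].
Proof.
move=> [n [p [b [hb fin sy]]]].
have [c hc] : {c : 'I_n -> W -> M & forall i, A (c i) /\ c i w = b i}.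
  apply: (@choice _ _ (fun i x => A x /\ x w = b i)) => i.
  by have [x Ax e] := hb i; exists x.
have e : b = (fun i => c i w) by apply: funext => i; rewrite (hc i).2.
exists (fun x w => sat p (fcons x (fun i => c i w))); rewrite -e; split=> //.
exists n.+1, p, (fcons (SVar 0) (fun i => SPar (c i))); split.
  by move=> i; rewrite /fcons; case: unlift => //= j; exact: (hc j).1.
move=> v w'; set f := fcons _ _; set g := fun i => _; suff -> : f = g by [].
apply: funext => i; rewrite /f /g.
by rewrite (fcons_comp (fun s => slot_val s v w')).
Qed.

(** Weakening that frees variable 1 for the quantified point in the recursions defining [lec] and
    [transv]. *)
Lemma gdef_shift2 D : gdef A D ->
  gdef A (fun v w => D (scons (v 0%N) (fun i => v i.+2)) w).
Proof.
move=> /(@gdef_subst _ _ _ _ _ (fun i =>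
  if i is j.+1 then SVar j.+2 else SVar 0)).
move=> h; apply: gdef_ext (h _) => [v w|[|i]] //.
set f := fun i => _; set g := scons _ _; suff -> : f = g by [].
by apply: funext => -[|i].
Qed.

Lemma gdef_lec D k : gdef A D ->
  gdef A (fun v w => lec k (fun y => D (scons y v) w)).
Proof.
elim: k D => [|k IH] D h.
  apply: gdef_ext (gdef_not (gdef_ex h)) => v w.
  by split=> [H|/lec0 H [x /H]//]; apply/lec0 => x Hx; apply: H; exists x.
pose D' v w := D (scons (v 0%N) (fun i => v i.+2)) w /\ v 0%N <> v 1%N.
have h' : gdef A D'.
  apply: gdef_and; first exact: gdef_shift2.
  exact: gdef_not (@gdef_eq _ _ _ _ (SVar 0) (SVar 1) _ _).
apply: gdef_ext (gdef_all (gdef_imp h (IH _ h'))) => v w.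
by split=> [H|/lecS H x]; [apply/lecS => x|]; exact: H.
Qed.

Lemma gdef_transv (F : M -> M -> W -> Prop) t D :
  gdef A (fun v w => F (v 0%N) (v 1%N) w) -> gdef A D ->
  gdef A (fun v w => transv (fun y a => F y a w) t (fun a => D (scons a v) w)).
Proof.
move=> hF; elim: t D => [|t IH] D h.
  apply: gdef_ext (gdef_all (gdef_not h)) => v w //.
pose D' v w := D (scons (v 0%N) (fun i => v i.+2)) w /\ ~ F (v 1%N) (v 0%N) w.
have h' : gdef A D'.
  apply: gdef_and; first exact: gdef_shift2.
  apply: gdef_not; pose ts i : slot W M := if i is 0 then SVar 1 else SVar 0.
  by apply: gdef_ext (@gdef_subst _ _ _ _ _ ts hF _) => // -[].
exact: gdef_ext (gdef_ex (IH _ h')).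
Qed.

End DefinableAcl.

(** * Transversals of definable families *)

Section Transversals.
Variable X : Type.
Implicit Types (F : X -> X -> Prop) (alpha : X -> Prop).

Lemma transv_sub F t alpha beta : (forall a, beta a -> alpha a) ->
  transv F t alpha -> transv F t beta.
Proof.
elim: t alpha beta => [|t IH] alpha beta ab /=.
  by move=> h a /ab; exact: h.
by move=> [y h]; exists y; apply: IH h => a [/ab].
Qed.

(** Some point of the transversal meets the set of [a0], and the points can be reordered so that it
    comes first. *)
Lemma transv_hit F t alpha a0 : transv F t.+1 alpha -> alpha a0 ->
  exists e, F e a0 /\ transv F t (fun a => alpha a /\ ~ F e a).
Proof.
elim: t alpha => [|t IH] alpha /= [y h] h0; case: (pselect (F y a0)) => Fy.
- by exists y.
- by case: (h a0).
- by exists y.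
have [e [Fe he]] := IH _ h (conj h0 Fy).
exists e; split=> //; exists y.
by apply: transv_sub he => a [[]].
Qed.

(** Fix an index [a0]. Every transversal of size [t.+1] has a point in the finite set of [a0];
    removing the indices met by that point leaves a family to which the induction hypothesis
    applies. *)
Lemma transv_finite F t alpha :
  (forall a, alpha a -> finite_set [set y | F y a]) -> ~ transv F t alpha ->
  finite_set [set y | transv F t (fun a => alpha a /\ ~ F y a)].
Proof.
elim: t alpha => [|t IH] alpha fin nt.
  have [a0 h0] : exists a, alpha a.
    by apply: contrapT => H; apply: nt => a ha; apply: H; exists a.
  apply: sub_finite_set (fin _ h0) => y /= H.
  by apply: contrapT => Fy; exact: (H a0).
case: (pselect (exists a, alpha a)) => [[a0 h0]|nE]; last first.
  set Y := [set y | _]; suff -> : Y = set0 by [].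
  apply/seteqP; split=> // y /(@transv_sub _ t.+1 _ alpha) h; apply: nt;
    apply: h.
  by move=> a ha; case: nE; exists a.
apply: (@sub_finite_set _ _ ([set y | F y a0] `|`
    \bigcup_(e in [set y | F y a0])
      [set y | transv F t (fun a => (alpha a /\ ~ F e a) /\ ~ F y a)])).
  move=> y hy; case: (pselect (F y a0)) => Fy; first by left.
  have [e [Fe he]] := transv_hit hy (conj h0 Fy).
  by right; exists e => //=; apply: transv_sub he => a [[]].
rewrite finite_setU; split; first exact: fin.
apply: bigcup_finite (fin _ h0) _ => e Fe; apply: IH => [a [/fin//]|h].
by apply: nt; exists e.
Qed.

Lemma transv_list F (gs : seq X) alpha :
  (forall a, alpha a -> exists g, List.In g gs /\ F g a) ->
  transv F (size gs) alpha.
Proof.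
elim: gs alpha => [|g gs IH] alpha h /=; first by move=> a /h[g []].
exists g; apply: IH => a [/h[g' [/= [<-//|ing] Fg]] _]; by exists g'.
Qed.

End Transversals.

(* A family of nonempty sets of bounded size, definable over [A] and having a
   finite transversal, has only finitely many transversals of the minimal size,
   so their union [Y] is contained in acl(A) and meets every set of the family.
   Removing [Y] decreases the bound. *)
Lemma transversal_acl (L : signature) (M : structure L) W (A : set (W -> M)) w
    (alpha : M -> W -> Prop) (F : M -> M -> W -> Prop) k (gs : seq M) :
  def1 A alpha -> gdef A (fun v w => F (v 0%N) (v 1%N) w) ->
  (exists a, alpha a w) -> (forall a, alpha a w -> lec k (fun y => F y a w)) ->
  (forall a, alpha a w -> exists g, List.In g gs /\ F g a w) ->
  exists g, List.In g gs /\ acl (side w A) g.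
Proof.
move=> dal; elim: k F => [|k IH] F dF [a0 h0] hk hgs.
  have [g [_ Fg]] := hgs _ h0.
  by have /lec0 h := hk _ h0; case: (h g).
pose tr t := transv (fun y a => F y a w) t (fun a => alpha a w).
(* The minimal size is a successor because a nonempty family has no transversal of size 0. *)
have [t trt trmin] : exists2 t, tr t.+1 & ~ tr t.
  have ex : exists t, `[< tr t >].
    by exists (size gs); apply/asboolP; exact: transv_list.
  have := ex_minnP ex; case=> -[|t] /asboolP ht hmin; first by case: (ht a0).
  exists t => // h.
  by have := hmin t; rewrite ltnn => H; apply: notF; apply: H; exact/asboolP.
pose Y y w := transv (fun y a => F y a w) t (fun a => alpha a w /\ ~ F y a w).
have dY : def1 A Y.
  pose D (v : nat -> M) w := alpha (v 0%N) w /\ ~ F (v 1%N) (v 0%N) w.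
  have dD : gdef A D.
    apply: gdef_and => //; apply: gdef_not.
    pose ts i : slot W M := if i is 0 then SVar 1 else SVar 0.
    by apply: gdef_ext (@gdef_subst _ _ _ _ _ ts dF _) => // -[].
  exact: (gdef_transv t dF dD).
have fY : finite_set [set y | Y y w].
  by apply: transv_finite trmin => a /hk /lec_finite.
case: (pselect (exists g, List.In g gs /\ Y g w)) => [[g [ing Yg]]|nY].
  by exists g; split=> //; exact: (def1_acl dY).
(* When [gs] misses [Y], it still meets every set after [Y] is removed, and each set has lost at
   least one point. *)
apply: (IH (fun y a w => F y a w /\ ~ Y y w)).
- by apply: gdef_and => //; exact: gdef_not.
- by exists a0.
- move=> a ha; have [e [Fe Ye]] := transv_hit trt ha.
  have /lecS/(_ e Fe) := hk _ ha.
  by apply: lec_sub => y [Fy nYy]; split=> // ye; apply: nYy; rewrite ye.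
- move=> a /hgs[g [ing Fg]]; exists g; split=> //; split=> // Yg.
  by apply: nY; exists g.
Qed.

(** * Partial elementary maps *)

(* The elements of [A] are the pairs (x, f x), encoded as [fun b => if b then x
   else f x], of a partial elementary map f. *)
Definition elem_map (L : signature) (M : structure L) (A : set (bool -> M)) :
    Prop :=
  forall m (q : formula L m) (z : 'I_m -> bool -> M), (forall i, A (z i)) ->
    (sat q (fun i => z i true) <-> sat q (fun i => z i false)).

(* Assignments in which [None] stands for a new element. *)
Definition oenv (X I : Type) n (z : 'I_n -> option (I -> X)) (u : X) (b : I) :
    'I_n -> X :=
  fun i => if z i is Some x then x b else u.

Definition oin (X : Type) (A : set X) (o : option X) : Prop :=
  if o is Some x then A x else True.

Section ElementaryMaps.
Variables (L : signature) (M : structure L).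
Implicit Types A X Y Z : set (bool -> M).

Lemma elem_transfer A D : elem_map A -> gdef A D ->
  (exists x, D (fun=> x) true) <-> (exists x, D (fun=> x) false).
Proof.
move=> eA /gdef_normal[m [p [b [hb H]]]].
have /= E := eA _ (FEx p) b hb.
split=> -[x /H hx].
  have [y hy] : exists y, sat p (fcons y (b ^~ false)) by apply/E; exists x.
  by exists y; apply/H.
have [y hy] : exists y, sat p (fcons y (b ^~ true)) by apply/E; exists x.
by exists y; apply/H.
Qed.

Lemma elem_transfer0 A (Q : bool -> Prop) : elem_map A ->
  gdef A (fun (_ : nat -> M) b => Q b) -> Q true <-> Q false.
Proof.
move=> eA /(elem_transfer eA) E; have [x0] := carrier_inhabited M.
by split=> q; [have [|_ //] := E.1 | have [|_ //] := E.2]; exists x0.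
Qed.

(** The union of finitely many finite definable sets, one for each algebraic entry of [l]. *)
Lemma acl_list A b (l : seq M) : exists E, [/\ def1 A E,
  finite_set [set y | E y b] &
  forall y, List.In y l -> acl (side b A) y -> E y b].
Proof.
elim: l => [|y l [E [dE fE hE]]].
  exists (fun _ _ => False); split=> //; exact: gdef_const.
case: (pselect (acl (side b A) y)) => [ay|nay]; last first.
  by exists E; split=> // x [<-//|]; exact: hE.
have [E' [dE' fE' hE']] := acl_def1 ay.
exists (fun x b => E x b \/ E' x b); split; first exact: gdef_or.
  by apply: (@sub_finite_set _ _ ([set x | E x b] `|` [set x | E' x b])) => //;
    rewrite finite_setU.
by move=> x /= [<- _|xl ax]; [right|left; exact: hE].
Qed.

(** Let [y] lie in finite sets [E] over [X] and [E'] over [Y]. On the true side their intersection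
    is finite and algebraic over [Z], so one finite set [E0] over [Z] contains it. This inclusion
    and the size bounds are definable over [A], hence transfer. *)
Lemma elem_acl_meet A X Y Z : elem_map A -> X `<=` A -> Y `<=` A -> Z `<=` A ->
  acl (side true X) `&` acl (side true Y) `<=` acl (side true Z) ->
  acl (side false X) `&` acl (side false Y) `<=` acl (side false Z).
Proof.
move=> eA XA YA ZA H y [aX aY].
have [E [dE fE Ey]] := acl_def1 aX; have [E' [dE' fE' Ey']] := acl_def1 aY.
have [k hk] := finite_lec fE; have [k' hk'] := finite_lec fE'.
have tr (E0 : M -> bool -> Prop) B n : B `<=` A -> def1 B E0 ->
    lec n (E0 ^~ true) <-> lec n (E0 ^~ false).
  move=> BA dE0; apply: (elem_transfer0 eA (Q := fun b => lec n (E0 ^~ b))).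
  exact: (gdef_lec n (gdef_sub BA dE0)).
have lk : lec k (E ^~ true) by apply/(tr _ X).
have lk' : lec k' (E' ^~ true) by apply/(tr _ Y).
have [l [_ hl]] := lk.
have [E0 [dE0 fE0 hE0]] := acl_list Z true l.
have [n hn] := finite_lec fE0.
have hn' : lec n (E0 ^~ false) by apply/(tr _ Z).
apply: (def1_acl dE0); first exact: lec_finite hn'.
have : forall x, (E x false /\ E' x false) -> E0 x false.
  apply/(elem_transfer0 eA
    (Q := fun b => forall x, (E x b /\ E' x b) -> E0 x b)); last first.
    move=> x [Ex Ex']; apply: hE0; first exact: hl.
    apply: H; split.
      by apply: (def1_acl dE) => //; exact: lec_finite lk.
    by apply: (def1_acl dE') => //; exact: lec_finite lk'.
  apply: (@gdef_all _ _ _ A (fun v b => (E (v 0%N) b /\ E' (v 0%N) b) ->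
    E0 (v 0%N) b)).
  apply: gdef_imp; last exact: gdef_sub dE0.
  by apply: gdef_and; [exact: gdef_sub dE|exact: gdef_sub dE'].
by apply.
Qed.

Lemma gdef_oenv A m (p : formula L m) (z : 'I_m -> option (bool -> M)) :
  (forall i, oin A (z i)) -> def1 A (fun u b => sat p (oenv z u b)).
Proof.
move=> hz; exists m, p, (fun i => if z i is Some x then SPar x else SVar 0).
split=> [i|v b]; first by have := hz i; case: (z i).
set f := oenv _ _ _; set g := fun i => _; suff -> : f = g by [].
by apply: funext => i; rewrite /f /g /oenv; case: (z i).
Qed.

Lemma gdef_oenv_fcons A m (p : formula L m.+1) (z : 'I_m -> option (bool ->
  M)) :
  (forall i, oin A (z i)) ->
  gdef A (fun v b => sat p (fcons (v 0%N) (oenv z (v 1%N) b))).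
Proof.
move=> hz; exists m.+1, p.
exists (fcons (SVar 0) (fun i => if z i is Some x then SPar x else SVar 1)).
split=> [i|v b].
  by rewrite /fcons; case: unlift => // j; have := hz j; case: (z j).
set f := fcons _ _; set g := fun i => _; suff -> : f = g by [].
apply: funext => i; rewrite /f /g (fcons_comp (fun s => slot_val s v b)).
by rewrite /oenv /fcons; case: unlift => // j; case: (z j).
Qed.

(** * Free extension of a partial elementary map by one element *)

Section FreeExtension.
Variables (A : set (bool -> M)) (a : M).

Definition type_cond (D : M -> Prop) : Prop :=
  exists m (p : formula L m) z, (forall i, oin A (z i)) /\
    D = fun u => sat p (oenv z u false) <-> sat p (oenv z a true).

(** With [type_cond] asking that [u] correspond to [a], this asks that [u] not make a new element
    [g] algebraic through [p] with at most [k] solutions. *)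
Definition acl_cond (D : M -> Prop) : Prop :=
  exists g m (p : formula L m.+1) z k, (forall i, oin A (z i)) /\
    D = fun u => acl (side false A) g \/
      ~ (lec k (fun y => sat p (fcons y (oenv z u false))) /\
         sat p (fcons g (oenv z u false))).

(** Finitely many conditions merge into one definable set containing [a] on the true side, one
    family of sets of bounded size, and a finite list of nonalgebraic elements to avoid. *)
Lemma free_conditions (l : seq (M -> Prop)) :
  (forall D, List.In D l -> type_cond D \/ acl_cond D) ->
  exists alpha F k gs, [/\ def1 A alpha /\ alpha a true,
    gdef A (fun v b => F (v 0%N) (v 1%N) b),
    (forall u, lec k (fun y => F y u false)),
    (forall g, List.In g gs -> ~ acl (side false A) g) &
    forall u, alpha u false -> (forall g, List.In g gs -> ~ F g u false) ->
      forall D, List.In D l -> D u].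
Proof.
elim: l => [_|D l IH hl].
  exists (fun _ _ => True), (fun _ _ _ => False), 0%N, [::]; split=> //.
  - by split=> //; exact: gdef_const.
  - exact: gdef_const.
  - by move=> u; apply/lec0 => y [].
have [|al [F [k [gs [[dal ala] dF hk hgs H]]]]] := IH; first by move=> D' ?;
  apply: hl; right.
have [] := hl D (or_introl erefl).
  move=> [m [p [z [hz eD]]]].
  (* The truth value of [p] at [a] is a fixed proposition, so at [true] the element [a] satisfies
     the new clause trivially. *)
  exists (fun u b => al u b /\ (sat p (oenv z u b) <-> sat p (oenv z a true))).
  exists F, k, gs; split=> //.
    by split=> //; apply: gdef_and => //; apply: gdef_iff;
      [exact: gdef_oenv|exact: gdef_const].
  by move=> u [alu pu] Fu D' [<-|]; [rewrite eD|exact: H].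
move=> [g [m [p [z [n [hz eD]]]]]].
case: (pselect (acl (side false A) g)) => [ag|nag].
  exists al, F, k, gs; split=> // u alu Fu D' [<-|]; last exact: H.
  by rewrite eD; left.
(* The bound is part of [F'], so its sets have at most [n] elements for every [u]. *)
pose F' y u b := lec n (fun y => sat p (fcons y (oenv z u b))) /\
                 sat p (fcons y (oenv z u b)).
exists al, (fun y u b => F y u b \/ F' y u b), (k + n)%N, (g :: gs); split=> //.
- apply: gdef_or => //; apply: gdef_and; last exact: gdef_oenv_fcons.
  pose ts (i : nat) : slot bool M := SVar i.+1.
  exact: (@gdef_subst _ _ _ _ _ ts (gdef_lec n (gdef_oenv_fcons p hz))).
- move=> u; apply: lecU => //.
  case: (pselect (lec n (fun y => sat p (fcons y (oenv z u false))))) => h.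
    by apply: lec_sub h => y [].
  by exists [::]; split=> // y [].
- by move=> g' [<-//|]; exact: hgs.
move=> u alu Fu D' [<-|inD].
  by rewrite eD; right => h; apply: (Fu g); [left|right].
by apply: H inD => // g' g'in h; apply: (Fu g'); [right|left].
Qed.

(** The definable set is nonempty on the false side by transfer. If none of its elements worked,
    [gs] would be a finite transversal, and [transversal_acl] would make one of its entries
    algebraic. *)
Lemma free_extension (l : seq (M -> Prop)) : elem_map A ->
  (forall D, List.In D l -> type_cond D \/ acl_cond D) ->
  exists u, forall D, List.In D l -> D u.
Proof.
move=> eA /free_conditions[al [F [k [gs [[dal ala] dF hk hgs H]]]]].
have [u0 hu0] : exists u, al u false.
  by apply/(elem_transfer eA dal); exists a.
apply: contrapT => nu.
have [||u alu|g [/hgs ng ag]] :=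
  transversal_acl (w := false) (k := k) (gs := gs) dal dF.
- by exists u0.
- by move=> u _; exact: hk.
- apply: contrapT => ng; apply: nu; exists u; apply: H => // g ing Fg.
  by apply: ng; exists g.
exact: ng.
Qed.

End FreeExtension.
End ElementaryMaps.

(** * Countability *)

Lemma countable_image (X Y : Type) (f : X -> Y) (A : set X) :
  countable A -> countable (f @` A).
Proof. exact: sub_countable (card_image_le f A). Qed.

Lemma countableU (X : Type) (A B : set X) :
  countable A -> countable B -> countable (A `|` B).
Proof.
move=> cA cB; rewrite -bigcup2E; apply: bigcup_countable => // -[|[|n]] _ //=.
Qed.

Lemma countable_tuples (X : Type) n (S : set X) : countable S ->
  countable [set b : 'I_n -> X | forall i, S (b i)].
Proof.
move=> /countable_injP[f finj]; apply/countable_injP.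
exists (fun b => pickle [seq f (b i) | i <- enum 'I_n]) => b c.
rewrite !inE => hb hc /(pcan_inj pickleK) /eq_in_map e.
by apply: funext => i; apply: finj; rewrite ?inE // e // mem_enum.
Qed.

Section CountableFormulas.
Variables (L : signature) (hL : countable_signature L).

Lemma countable_encoding (X : Type) : countable [set: X] ->
  exists f : X -> nat, injective f.
Proof.
move=> /countable_injP[f finj]; exists f => x y e.
by apply: finj; rewrite ?inE.
Qed.

Let ef := sval (cid (countable_encoding hL.1)).
Let er := sval (cid (countable_encoding hL.2)).
Let ef_inj : injective ef := svalP (cid (countable_encoding hL.1)).
Let er_inj : injective er := svalP (cid (countable_encoding hL.2)).

Fixpoint term_code n (t : term L n) : GenTree.tree nat :=
  match t with
  | TVar i => GenTree.Leaf (i : nat)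
  | TApp f ts => GenTree.Node (ef f) [seq term_code (ts i) | i <- enum
    'I_(func_ar f)]
  end.

Lemma term_code_inj n : injective (@term_code n).
Proof.
elim=> [i|f ts IH] [j|g us] //= [].
  by move=> /val_inj ->.
move=> /ef_inj e; case: g / e us => us /eq_in_map e.
by congr TApp; apply: funext => i; apply: IH; apply: e; rewrite mem_enum.
Qed.

Fixpoint formula_code n (p : formula L n) : GenTree.tree nat :=
  match p with
  | FEq _ t u => GenTree.Node 0 [:: term_code t; term_code u]
  | FRel _ r ts =>
      GenTree.Node 1 (GenTree.Leaf (er r) :: [seq term_code (ts i) | i <- enum
        'I_(rel_ar r)])
  | FNot _ p => GenTree.Node 2 [:: formula_code p]
  | FAnd _ p q => GenTree.Node 3 [:: formula_code p; formula_code q]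
  | FEx _ p => GenTree.Node 4 [:: formula_code p]
  end.

Lemma formula_code_inj n : injective (@formula_code n).
Proof.
(* The two arities are kept apart and linked by transport, so that both formulas can be analysed by
   cases. *)
suff H m (p : formula L m) k (q : formula L k) (e : m = k) :
    formula_code p = formula_code q -> eq_rect m (formula L) p k e = q.
  by move=> p q /(H _ _ _ _ erefl).
elim: p k q e => {m} [m t u|m r ts|m p IH|m p IH p' IH'|m p IH] k
  [{}k t' u'|{}k r' ts'|{}k q|{}k q q'|{}k q] //= e; destruct e => /=.
- by move=> [/term_code_inj -> /term_code_inj ->].
- move=> [/er_inj e]; case: r' / e ts' => ts' /eq_in_map e.
  congr FRel; apply: funext => i; apply: term_code_inj.
  by apply: e; rewrite mem_enum.
- by move=> [/(IH _ _ erefl) /= ->].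
- by move=> [/(IH _ _ erefl) /= -> /(IH' _ _ erefl) /= ->].
- by move=> [/(IH _ _ erefl) /= ->].
Qed.

Lemma countable_formula n : countable [set: formula L n].
Proof.
apply/countable_injP; exists (fun p => pickle (formula_code p)) => p q _ _.
by move=> /(pcan_inj pickleK) /formula_code_inj.
Qed.

End CountableFormulas.

(** * Almost sure properties *)

Section AlmostEverywhere.
Variables (R : realType) (d : measure_display) (Om : measurableType d).
Variable P : probability Om R.

(** The exceptional set has only to lie in a null set, so such statements combine before
    measurability is known; completeness of [P] recovers it in [ae_probability1]. *)
Definition ae (D : Om -> Prop) : Prop := P.-negligible (~` [set w | D w]).

Lemma aeS (D D' : Om -> Prop) : (forall w, D w -> D' w) -> ae D -> ae D'.
Proof. by move=> DD'; apply: negligibleS => w /= H /DD'. Qed.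

Lemma aeI (D D' : Om -> Prop) : ae D -> ae D' -> ae (fun w => D w /\ D' w).
Proof.
move=> h h'; apply: negligibleS (negligibleU h h') => w /= H.
by case: (pselect (D w)) => Dw; [right => D'w; apply: H|left].
Qed.

Lemma ae_countable (I : Type) (S : set I) (D : I -> Om -> Prop) : countable S ->
  (forall i, S i -> ae (D i)) -> ae (fun w => forall i, S i -> D i w).
Proof.
move=> /countable_injP[f finj] h.
pose F n := \bigcup_(i in [set i | S i /\ f i = n]) ~` [set w | D i w].
apply: (@negligibleS _ _ _ _ (\bigcup_n F n)).
  move=> w /= /existsNP[i /not_implyP[Si Di]].
  by exists (f i) => //; exists i.
apply: negligible_bigcup => n.
case: (pselect (exists i, S i /\ f i = n)) => [[i [Si fi]]|no].
  apply: negligibleS (h i Si) => w [j [Sj fj]].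
  by rewrite (finj j i) ?inE // fj fi.
by apply: negligibleS (negligible_set0 P) => w [j hj]; case: no; exists j.
Qed.

Lemma ae_forall_nat (D : nat -> Om -> Prop) :
  (forall n, ae (D n)) -> ae (fun w => forall n, D n w).
Proof.
move=> h; apply: aeS (@ae_countable nat setT D _ _) => // w H n; exact: H.
Qed.

Lemma ae_probability1 (D : Om -> Prop) : measure_is_complete P -> ae D ->
  measurable [set w | D w] /\ P [set w | D w] = 1%E.
Proof.
move=> cP h; have mC := cP _ h; have mD := measurableC mC.
rewrite -(setCK [set w | D w]); split=> //.
by rewrite probability_setC // (measure_negligible mC h) sube0.
Qed.

Lemma probability1_ae (E : set Om) : measurable E -> P E = 1%E -> ae E.
Proof.
move=> mE PE; have PC : P (~` E) = 0%E by rewrite probability_setC // PE subee.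
exists (~` E); split=> //; exact: measurableC.
Qed.

End AlmostEverywhere.

Lemma measurable_exists (d : measure_display) (Om : measurableType d) (I : Type)
    (S : set I) (D : I -> Om -> Prop) : countable S ->
  (forall i, S i -> measurable [set w | D i w]) ->
  measurable [set w | exists2 i, S i & D i w].
Proof.
move=> /countable_injP[f finj] mD.
have -> : [set w | exists2 i, S i & D i w] =
    \bigcup_n \bigcup_(i in [set i | S i /\ f i = n]) [set w | D i w].
  apply/seteqP; split=> [w [i Si Di]|w [n _ [i [Si _] Di]]]; last by exists i.
  by exists (f i) => //; exists i.
apply: bigcup_measurable => n _.
apply: fin_bigcup_measurable => [|i [Si _]]; last exact: mD.
case: (pselect (exists i, S i /\ f i = n)) => [[i [Si fi]]|no].
  apply: (@sub_finite_set _ _ [set i]) => [j [Sj fj]|]; last exact: finite_set1.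
  by apply: finj; rewrite ?inE // fj fi.
apply: (@sub_finite_set _ _ set0) => [j hj|]; last exact: finite_set0.
by case: no; exists j.
Qed.

(** * Randomizations *)

Lemma In_map (X Y : Type) (f : X -> Y) (l : seq X) y :
  List.In y [seq f x | x <- l] <-> exists x, f x = y /\ List.In x l.
Proof.
elim: l => [|x l IH] /=; first by split=> [|[x []]].
rewrite IH; split=> [[<-|[z [e zl]]]|[z [<- [->|zl]]]].
- by exists x; split=> //; left.
- by exists z; split=> //; right.
- by left.
- by right; exists z.
Qed.

Lemma finite_list (X : Type) (F : set X) : finite_set F ->
  exists l, forall x, List.In x l <-> F x.
Proof.
move=> /(@finite_lec _ F)[k [l [_ hl]]].
exists (List.filter (fun x => `[< F x >]) l) => x; rewrite List.filter_In.
by split=> [[_ /asboolP]|Fx] //; split; [exact: hl|exact/asboolP].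
Qed.

(** * Fullness as definable choice of random elements *)

Section Fullness.
Variables (L : signature) (M : structure L) (R : realType).
Variables (d : measure_display) (Om : measurableType d).
Variables (P : probability Om R) (J : set (Om -> M)).
Hypothesis HJ : neat_randomization P J.

(** Fullness provides a Skolem function in [J]: one element is a witness at every [w] that has
    one. *)
Lemma full_def1 (E : M -> Om -> Prop) : def1 J E ->
  exists2 v, J v & forall w, (exists u, E u w) -> E (v w) w.
Proof.
move=> /gdef_normal[m [p [b [hb H]]]].
have [v Jv hv] := neat_full HJ p hb.
exists v => // w [u /H hu]; apply/H.
have : event (FEx p) b w by exists u.
rewrite -hv /event /=; set f := fun i => _; suff ->
  : f = fcons (v w) (b ^~ w) by [].
by apply: funext => i; rewrite /f (fcons_comp (fun x => x w)).
Qed.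

Lemma measurable_def1 (E : M -> Om -> Prop) v : def1 J E -> J v ->
  measurable [set w | E (v w) w].
Proof.
move=> /gdef_normal[m [p [b [hb H]]]] Jv.
suff -> : [set w | E (v w) w] = event p (fcons v b).
  by apply: (neat_event HJ) => i; rewrite /fcons; case: unlift.
apply/funext => w; apply/propext; rewrite /event /= H.
set f := fcons _ _; set g := fun i => _; suff -> : f = g by [].
by apply: funext => i; rewrite /f /g (fcons_comp (fun x => x w)).
Qed.

(** Every measurable set is an event with parameters in [J]. This admits conditions such as
    algebraicity, which no single formula expresses. *)
Lemma gdef_measurable (B : set Om) : measurable B -> gdef J (fun _ w => B w).
Proof.
move=> /(neat_event_onto HJ)[n [p [a [Ja ->]]]].
by exists n, p, (fun i => SPar (a i)).
Qed.

Lemma J_inhabited : exists v, J v.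
Proof.
have [v Jv _] := full_def1 (E := fun _ _ => True) (gdef_const J True);
  exists v; exact: Jv.
Qed.

(* Each solution is chosen distinct from the previous ones, so a finite set of
   solutions is exhausted. *)
Lemma enumerate_solutions n (p : formula L n.+1) (b : 'I_n -> Om -> M) :
  (forall i, J (b i)) -> exists G : set (Om -> M), [/\ countable G, G `<=` J &
    forall w x, finite_set [set x | sat p (fcons x (b ^~ w))] ->
      sat p (fcons x (b ^~ w)) -> side w G x].
Proof.
move=> Jb; pose S x w := sat p (fcons x (b ^~ w)).
have dS : def1 J S.
  exists n.+1, p, (fcons (SVar 0) (fun i => SPar (b i))); split.
    by move=> i; rewrite /fcons; case: unlift => //= j; exact: Jb.
  move=> v w; rewrite /S; set f := fcons _ _; set g := fun i => _.
  by suff -> : f = g by []; apply: funext => i;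
    rewrite /f /g (fcons_comp (fun s => slot_val s v w)).
pose new (l : seq (Om -> M)) x w :=
  S x w /\ forall g, List.In g l -> g w <> x.
have dnew l : (forall g, List.In g l -> J g) -> def1 J (new l).
  move=> Jl; apply: gdef_and => //; elim: l Jl => [|g l IH] Jl.
    by apply: gdef_ext (@gdef_const _ M _ J True) => v w; split.
  have Jg : J g by apply: Jl; left.
  have dg := gdef_not (@gdef_eq _ _ _ J (SPar g) (SVar 0) Jg I).
  apply: gdef_ext (gdef_and dg (IH _)) => [v w|g' h]; last by apply: Jl; right.
  split=> [[h h'] g' [<-//|]|h]; first exact: h'.
  by split=> [|g' h']; apply: h; [left|right].
have [nx hnx] : {nx : seq (Om -> M) -> Om -> M & forall l,
    (forall g, List.In g l -> J g) -> J (nx l) /\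
    forall w, (exists u, new l u w) -> new l (nx l w) w}.
  apply: (@choice _ _ (fun l v => (forall g, List.In g l -> J g) -> J v /\
    forall w, (exists u, new l u w) -> new l (v w) w)) => l.
  case: (pselect (forall g, List.In g l -> J g)) => Jl; last first.
    by have [v Jv] := J_inhabited; exists v.
  by have [v Jv hv] := full_def1 (dnew l Jl); exists v.
pose fix ls k := if k is k.+1 then nx (ls k) :: ls k else [::].
have Jls k : forall g, List.In g (ls k) -> J g.
  by elim: k => //= k IH g [<-|/IH//]; exact: (hnx _ IH).1.
exists (\bigcup_k [set g | List.In g (ls k)]); split.
- apply: bigcup_countable => // k _; apply: finite_set_countable.
  elim: (ls k) => [|g l IH] /=.
    by rewrite (_ : [set g | False] = set0) //; apply/seteqP; split.
  have -> : [set g' | g = g' \/ List.In g' l] = [set g] `|` [set g' | List.In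
    g' l].
    by apply/seteqP; split=> g' /= [->|]; [left|right|left|right].
  by rewrite finite_setU.
- by move=> g [k _]; exact: Jls.
(* If [x] were missed at [w], it would remain new at each stage, so [ls j] would take [j] distinct
   solutions as values at [w], against the bound [k]. *)
move=> w x fin Sx; apply: contrapT => nx'.
have [k [l [sl hl]]] := finite_lec (E := S ^~ w) fin.
have H j : [/\ List.NoDup [seq g w | g <- ls j], size (ls j) = j &
    forall g, List.In g (ls j) -> S (g w) w].
  elim: j => [|j [nd sz IH]] /=; first by split=> //; constructor.
  have [|Snx Nnx] := (hnx _ (Jls j)).2 w.
    exists x; split=> // g gin e; apply: nx'; exists g => //.
    by exists j.
  split; last by move=> g [<-|/IH].
    constructor => // h.
    have [g [e gin]] := (In_map _ _ _).1 h.
    exact: (Nnx g).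
  by rewrite sz.
have [nd sz hS] := H k.+1.
have : (size [seq g w | g <- ls k.+1] <= size l)%N.
  apply/leP; apply: List.NoDup_incl_length nd _ => y hy.
  have [g [<- gin]] := (In_map _ _ _).1 hy.
  exact: hl (hS _ gin).
by rewrite size_map sz => /leq_trans /(_ sl); rewrite ltnn.
Qed.

Lemma def1_finite (F : set (M -> Om -> Prop)) : finite_set F ->
  (forall E, F E -> def1 J E) -> def1 J (fun u w => forall E, F E -> E u w).
Proof.
move=> /finite_list[l hl] dF.
have {}dF : forall E, List.In E l -> def1 J E by move=> E /hl /dF.
suff H : gdef J (fun v w => forall E, List.In E l -> E (v 0%N) w).
  by apply: gdef_ext H => v w; split=> H E /hl; exact: H.
elim: l {hl} dF => [|E l IH] dF.
  by apply: gdef_ext (gdef_const J True) => v w; split.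
have dE := dF E (or_introl erefl).
apply: gdef_ext (gdef_and dE (IH _)) => [v w|E' E'l]; last by apply: dF; right.
split=> [[h h'] E' [<-//|]|h]; first exact: h'.
by split=> [|E' E'l]; apply: h; [left|right].
Qed.

End Fullness.

(** * Events, saturation and elementary sets of pairs in the big randomization *)

Section BigRandomization.
Variables (L : signature) (M : structure L) (R : realType).
Variables (d : measure_display) (Om : measurableType d).
Variables (P : probability Om R) (J : set (Om -> M)).
Variables (HJ : neat_randomization P J) (N : prestructure R L).
Variables (red : reduction (randomization HJ) N).
Variables (rep : sortK N -> sortK (randomization HJ)).
Hypothesis hrep : forall b, redK red (rep b) = b.
Hypothesis metN : metric_structure N.

Definition fn (x : sortK N) : Om -> M := sval (rep x).

Lemma J_fn x : J (fn x). Proof. exact: svalP (rep x). Qed.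

Lemma measurable_sat n (p : formula L n) (x : 'I_n -> sortK N) :
  measurable [set w | sat p (fun i => fn (x i) w)].
Proof. by apply: (neat_event HJ) => i; exact: J_fn. Qed.

Lemma evK_rep n (p : formula L n) (x : 'I_n -> sortK N) :
  evK p x = redB red (evK p (fun i => rep (x i))).
Proof. by rewrite -red_ev; congr (evK p); apply: funext => i; rewrite hrep. Qed.

Lemma fine_probability0 (A : set Om) : measurable A ->
  fine (P A) = 0%R <-> P.-negligible A.
Proof.
move=> mA; split=> [h|h].
  apply/negligibleP => //.
  by have := fin_num_measure P _ mA => /fineK <-; rewrite h.
by rewrite (measure_negligible mA h).
Qed.

Lemma ae_evK_eq n (p : formula L n) (x x' : 'I_n -> sortK N) :
  evK p x = evK p x' <->
  ae P (fun w => sat p (fun i => fn (x i) w) <-> sat p (fun i => fn (x' i) w)).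
Proof.
have [_ [dist0 _ _ _]] := metN.
rewrite -dist0 !evK_rep red_distB /= fine_probability0; last first.
  by apply: measurableU; apply: measurableD; exact: measurable_sat.
rewrite /event /fn; split; apply: negligibleS => w /=.
  move=> h; case: (pselect (sat p (fun i => sval (rep (x i)) w))) => s.
    by left; split=> // s'; apply: h.
  by right; split=> //; apply: contrapT => s'; apply: h.
by move=> [[s s'] h|[s s'] h]; apply: s'; apply/h.
Qed.

(** The chosen representative of the class of [a] is at distance 0 from [a]. *)
Lemma ae_fn_red (a : sortK (randomization HJ)) :
  ae P (fun w => fn (redK red a) w = sval a w).
Proof.
have [[dist0 _ _ _] _] := metN.
have /= : distK (rep (redK red a)) a = 0%R.
  by rewrite -(red_distK red) hrep; apply/dist0.
rewrite fine_probability0; first by apply: negligibleS => w.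
have h : def1 J (fun u w => fn (redK red a) w <> u).
  exact: gdef_not (@gdef_eq _ _ _ J (SPar _) (SVar 0) (J_fn _) I).
exact: measurable_def1 HJ _ _ h (svalP a).
Qed.

Hypothesis satN : csaturated N.
Hypothesis uncN : ~ countable [set: (sortK N + sortB N)%type].

(** The continuous condition says that the complement of the defining event has measure 0; its
    parameters are the classes of those of [E]. *)
Lemma def1_condition (E : M -> Om -> Prop) : def1 J E ->
  exists c : param_cformula N 1 0, forall x y,
    pc_sat c x y <-> ae P (fun w => E (fn (x ord0) w) w).
Proof.
move=> /gdef_normal[m [p [b [hb H]]]].
pose b' i : sortK (randomization HJ) := exist _ (b i) (hb i).
pose f : cformula R L (1 + m) (0 + 0) :=
  CMu R (BCompl (@BEvent L (1 + m) (0 + 0) m.+1 p (fun i => i))).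
exists (@ParamCFormula R L N 1 0 m 0 f (fun i => redK red (b' i)) (@no_args _)).
move=> x y; rewrite /pc_sat /=.
have -> : (fun i : 'I_m.+1 => fcat x (fun i => redK red (b' i)) i) =
          (fun i => redK red (fcons (rep (x ord0)) b' i)).
  rewrite fcat1; apply: funext => i.
  by rewrite (fcons_comp (redK red)) hrep.
rewrite red_ev red_compl red_mu /= fine_probability0; last first.
  apply: measurableC; apply: (neat_event HJ) => i; exact: svalP.
have e w : (fun i => sval (fcons (rep (x ord0)) b' i) w) =
           fcons (fn (x ord0) w) (b ^~ w).
  by apply: funext => i; rewrite (fcons_comp (fun a => sval a w)).
rewrite /event; split; apply: negligibleS => w /=; first by rewrite e H.
by rewrite e -H.
Qed.

Lemma realize (S : set (M -> Om -> Prop)) : countable S ->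
  (forall E, S E -> def1 J E) ->
  (forall F, finite_set F -> F `<=` S ->
     ae P (fun w => exists u, forall E, F E -> E u w)) ->
  exists v, forall E, S E -> ae P (fun w => E (fn v w) w).
Proof.
move=> cS dS finS.
have [c hc] : {c : (M -> Om -> Prop) -> param_cformula N 1 0 & forall E,
    S E -> forall x y, pc_sat (c E) x y <-> ae P (fun w =>
      E (fn (x ord0) w) w)}.
  apply: (@choice _ _ (fun E c => S E -> forall x y,
    pc_sat c x y <-> ae P (fun w => E (fn (x ord0) w) w))) => E.
  case: (pselect (S E)) => [/dS/def1_condition[c hc]|nS]; first by exists c.
  have [c _] := def1_condition (E := fun _ _ => True) (gdef_const J True).
  by exists c.
(* All parameters of the chosen conditions form a countable set, which is small since [N] is
   uncountable. *)
pose A := \bigcup_(E in S)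
  ([set inl (@pc_paramK _ _ _ _ _ (c E) i) | i in setT] `|`
   [set inr (@pc_paramB _ _ _ _ _ (c E) i) | i in setT])
  : set (sortK N + sortB N)%type.
have cA : countable A.
  apply: bigcup_countable => // E _; apply: finite_set_countable.
  by rewrite finite_setU; split; apply: finite_image; exact: finite_finset.
have [|G|G0 fG0 G0S|x [y hxy]] := satN (A := A) _ (G := [set c E | E in S]).
- by move=> AN; apply: uncN; exact: sub_countable AN cA.
- by move=> [E SE <-]; split=> i; exists E => //; [left|right]; exists i.
- have [g hg] : {g : param_cformula N 1 0 -> M -> Om -> Prop &
      forall p, G0 p -> S (g p) /\ c (g p) = p}.
    apply: (@choice _ _ (fun p E => G0 p -> S E /\ c E = p)) => p.
    case: (pselect (G0 p)) => [/G0S[E SE e]|]; first by exists E.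
    by exists (fun _ _ => True).
  have gS : g @` G0 `<=` S by move=> E [p G0p <-]; exact: (hg p G0p).1.
  have dF : def1 J (fun u w => forall E, (g @` G0) E -> E u w).
    by apply: def1_finite; [exact: finite_image|move=> E /gS /dS].
  (* A single random element solves the finite set of conditions wherever it is solvable, hence
     almost surely. *)
  have [v Jv hv] := full_def1 HJ dF.
  pose a : sortK (randomization HJ) := exist _ v Jv.
  exists (fun=> redK red a), (@no_args _) => p G0p.
  have [Sg <-] := hg p G0p; apply/hc => //.
  apply: aeS (aeI (ae_fn_red a) (finS _ (finite_image _ fG0) gS)) => w /= [->
    h].
  by apply: hv => //; exists p.
exists (x ord0) => E SE; apply/(hc E SE x y); apply: hxy; by exists E.
Qed.

Definition pw (A : set (bool -> sortK N)) (w : Om) : set (bool -> M) :=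
  [set (fun b => fn (x b) w) | x in A].

Definition elemN (A : set (bool -> sortK N)) : Prop :=
  forall m (q : formula L m) (z : 'I_m -> bool -> sortK N), (forall i,
    A (z i)) ->
    evK q (fun i => z i true) = evK q (fun i => z i false).

Definition pair_fun (X : Type) (a v : X) : bool -> X := fun b =>
  if b then a else v.

Definition oeval m (z : 'I_m -> option (bool -> sortK N)) (w : Om) :
    'I_m -> option (bool -> M) :=
  fun i => omap (fun x b => fn (x b) w) (z i).

Lemma oeval_in A m (z : 'I_m -> option (bool -> sortK N)) w :
  (forall i, oin A (z i)) -> forall i, oin (pw A w) (oeval z w i).
Proof. by move=> hz i; have := hz i; rewrite /oeval; case: (z i) => //= x;
  exists x. Qed.

Hypothesis hL : countable_signature L.

(** There are countably many formulas and tuples of pairs, so the almost sure equivalences hold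
    simultaneously. *)
Lemma elemN_ae A : countable A -> elemN A ->
  ae P (fun w => elem_map (pw A w)).
Proof.
move=> cA eA.
have : ae P (fun w => forall m (q : formula L m), setT q ->
    forall z : 'I_m -> bool -> sortK N, (forall i, A (z i)) ->
    (sat q (fun i => fn (z i true) w) <-> sat q (fun i => fn (z i false) w))).
  apply: ae_forall_nat => m; apply: ae_countable (countable_formula hL m) _ =>
    q _.
  apply: ae_countable (countable_tuples m cA) _ => z hz.
  by apply/ae_evK_eq; exact: eA.
apply: aeS => w H m q z hz.
have [c hc] : {c : 'I_m -> bool -> sortK N & forall i,
    A (c i) /\ (fun b => fn (c i b) w) = z i}.
  apply: (@choice _ _ (fun i x => A x /\ (fun b => fn (x b) w) = z i)) => i.
  by have [x Ax <-] := hz i; exists x.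
have e : z = fun i b => fn (c i b) w by apply: funext => i; rewrite (hc i).2.
by rewrite e; apply: H => // i; exact: (hc i).1.
Qed.

(** * Adding one random element freely *)

Section FreeStep.
Variables (A : set (bool -> sortK N)) (cA : countable A) (eA : elemN A).
Variables (G : set (Om -> M)) (cG : countable G) (GJ : G `<=` J).
Variable a : sortK N.

(** Algebraicity is a countable union of events, one for each formula, parameter tuple and bound [k]
    on the number of solutions. *)
Lemma measurable_acl g : J g ->
  measurable [set w | acl (side false (pw A w)) (g w)].
Proof.
move=> Jg.
pose E m (p : formula L m.+1) (z : 'I_m -> bool -> sortK N) k x w :=
  lec k (fun y => sat p (fcons y (fun i => fn (z i false) w))) /\
  sat p (fcons x (fun i => fn (z i false) w)).
have -> : [set w | acl (side false (pw A w)) (g w)] =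
    [set w | exists2 m, [set: nat] m & exists2 p : formula L m.+1, setT p &
      exists2 z, [set z : 'I_m -> bool -> sortK N | forall i, A (z i)] z &
      exists2 k, [set: nat] k & E m p z k (g w) w].
  apply/seteqP; split=> w /=.
    move=> [m [p [b [hb fin sg]]]].
    have [z hz] : {z : 'I_m -> bool -> sortK N & forall i,
        A (z i) /\ fn (z i false) w = b i}.
      apply: (@choice _ _ (fun i x => A x /\ fn (x false) w = b i)) => i.
      by have [_ [x Ax <-] <-] := hb i; exists x.
    have e : b = fun i => fn (z i false) w by apply: funext => i;
      rewrite (hz i).2.
    exists m => //; exists p => //; exists z; first by move=> i;
      exact: (hz i).1.
    have [k hk] := finite_lec fin.
    by exists k => //; rewrite /E -e.
  move=> [m _ [p _ [z hz [k _ [hk sg]]]]].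
  exists m, p, (fun i => fn (z i false) w); split=> //;
    last exact: lec_finite hk.
  by move=> i; exists (fun b => fn (z i b) w) => //; exists (z i).
apply: measurable_exists => // m _.
apply: measurable_exists => [|p _]; first exact: countable_formula.
apply: measurable_exists => [|z _]; first exact: countable_tuples.
apply: measurable_exists => // k _.
apply: (measurable_def1 HJ (E := E m p z k) _ Jg).
have h : gdef J (fun v w => sat p (fcons (v 0%N) (fun i => fn (z i false) w))).
  exists m.+1, p, (fcons (SVar 0) (fun i => SPar (fn (z i false)))); split.
    by move=> i; rewrite /fcons; case: unlift => //= j; exact: J_fn.
  move=> v w; set f := fcons _ _; set f' := fun i => _; suff -> : f = f' by [].
  by apply: funext => i; rewrite /f /f' (fcons_comp (fun s => slot_val s v w)).
exact: gdef_and (gdef_lec k h) h.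
Qed.

(** At each [w], this and [acl_event] are instances of [type_cond] and [acl_cond] for the partial
    map [pw A w] and the value of [a]. *)
Definition type_event m (p : formula L m) z : M -> Om -> Prop := fun u w =>
  sat p (oenv (oeval z w) u false) <-> sat p (oenv (oeval z w) (fn a w) true).

Definition acl_event g m (p : formula L m.+1) z k : M -> Om -> Prop :=
  fun u w =>
  acl (side false (pw A w)) (g w) \/
  ~ (lec k (fun y => sat p (fcons y (oenv (oeval z w) u false))) /\
     sat p (fcons (g w) (oenv (oeval z w) u false))).

Lemma def1_type_event m (p : formula L m) z : def1 J (type_event p z).
Proof.
apply: gdef_iff.
  exists m, p, (fun i => if z i is Some x then SPar (fn (x false)) else SVar 0).
  split=> [i|v w]; first by case: (z i) => //= x; exact: J_fn.
  set f := oenv _ _ _; set g := fun i => _; suff -> : f = g by [].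
  by apply: funext => i; rewrite /f /g /oenv /oeval; case: (z i).
exists m, p, (fun i => SPar (if z i is Some x then fn (x true) else fn a)).
split=> [i|v w]; first by case: (z i) => [x|]; exact: J_fn.
set f := oenv _ _ _; set g := fun i => _; suff -> : f = g by [].
by apply: funext => i; rewrite /f /g /oenv /oeval; case: (z i).
Qed.

Lemma def1_acl_event g m (p : formula L m.+1) z k : J g ->
  def1 J (acl_event g p z k).
Proof.
move=> Jg; apply: gdef_or.
  exact: (gdef_measurable HJ (measurable_acl Jg)).
pose zs i : slot Om M := if z i is Some x then SPar (fn (x false)) else SVar 1.
have h : gdef J (fun v w =>
  sat p (fcons (v 0%N) (oenv (oeval z w) (v 1%N) false))).
  exists m.+1, p, (fcons (SVar 0) zs); split.
    move=> i; rewrite /fcons; case: unlift => //= j; rewrite /zs.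
    by case: (z j) => //= x; exact: J_fn.
  move=> v w; set f := fcons _ _; set f' := fun i => _; suff -> : f = f' by [].
  apply: funext => i; rewrite /f /f' (fcons_comp (fun s => slot_val s v w)).
  by rewrite /fcons; case: unlift => // j; rewrite /oenv /oeval /zs;
    case: (z j).
apply: gdef_not; apply: gdef_and; first exact: (gdef_lec k h).
pose ts (i : nat) : slot Om M := if i is 0 then SPar g else SVar 0.
by apply: gdef_ext (@gdef_subst _ _ _ _ _ ts h _) => // -[].
Qed.

Lemma free_step : exists v, elemN (A `|` [set pair_fun a v]) /\
  ae P (fun w => forall g, G g ->
    acl (side false (pw (A `|` [set pair_fun a v]) w)) (g w) ->
    acl (side false (pw A w)) (g w)).
Proof.
pose Z m := [set z : 'I_m -> option (bool -> sortK N) | forall i, oin A (z i)].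
have cZ m : countable (Z m).
  apply: (@countable_tuples _ m [set o | oin A o]).
  have -> : [set o | oin A o] = [set None] `|` [set Some x | x in A].
    apply/seteqP; split=> [[x|] /=|_ [->|[x Ax <-]]] //; last by left.
    by right; exists x.
  apply: countableU; [exact: countable1|exact: countable_image].
pose S1 := \bigcup_m \bigcup_(p in [set: formula L m]) [set type_event p z | z
  in Z m].
pose S2 := \bigcup_(g in G) \bigcup_m \bigcup_(p in [set: formula L m.+1])
  \bigcup_k [set acl_event g p z k | z in Z m].
have cS : countable (S1 `|` S2).
  apply: countableU.
    apply: bigcup_countable => // m _.
    apply: bigcup_countable => [|p _]; first exact: countable_formula.
    exact: countable_image.
  apply: bigcup_countable => // g _; apply: bigcup_countable => // m _.
  apply: bigcup_countable => [|p _]; first exact: countable_formula.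
  apply: bigcup_countable => // k _; exact: countable_image.
have [|F fF FS|v hv] := realize cS.
- move=> E [[m _ [p _ [z hz <-]]]|[g Gg [m _ [p _ [k _ [z hz <-]]]]]].
    exact: def1_type_event.
  by apply: def1_acl_event; exact: GJ.
(* Finite satisfiability: at almost every [w] the pairs form a partial elementary map, to which
   [free_extension] applies. *)
- apply: aeS (elemN_ae cA eA) => w ew.
  have [l hl] := finite_list fF.
  have [|u hu] := free_extension (a := fn a w)
    (l := [seq (fun u => E u w) | E <- l]) ew.
    move=> D /In_map[E [<- /hl/FS[[m _ [p _ [z hz <-]]]|[g Gg [m _ [p _ [k _ [z
      hz <-]]]]]]]].
      by left; exists m, p, (oeval z w); split=> //; exact: oeval_in.
    by right; exists (g w), m, p, (oeval z w), k; split=> //; exact: oeval_in.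
  exists u => E FE; apply: (hu (fun u => E u w)).
  by apply/In_map; exists E; split=> //; apply/hl.
exists v; split.
  move=> m q z hz.
  (* An entry of [z] outside [A] must be the new pair, encoded by [None]. *)
  pose oz i := if pselect (A (z i)) then Some (z i) else None.
  have Zoz : Z m oz by move=> i; rewrite /oz; case: pselect.
  have S1oz : S1 (type_event q oz) by exists m => //; exists q => //; exists oz.
  apply/ae_evK_eq; apply: aeS (hv _ (or_introl S1oz)) => w; rewrite /type_event.
  have e u b : u = pair_fun a v b ->
      oenv (oeval oz w) (fn u w) b = fun i => fn (z i b) w.
    move=> ->; apply: funext => i; rewrite /oenv /oeval /oz.
    by case: pselect => //= nA; case: (hz i) => // ->.
  by rewrite (e v false) // (e a true) //; case=> h h'; split.
apply: aeS (ae_countable cS hv) => w H g Gg [m [p [b [hb fin sg]]]].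
(* The parameters of a formula making [g w] algebraic come from [A] or from [v]. With a bound [k] on
   its solutions, the corresponding [acl_event] leaves only its first alternative. *)
have [z hz] : {z : 'I_m -> option (bool -> sortK N) & forall i,
    oin A (z i) /\ oenv (oeval z w) (fn v w) false i = b i}.
  apply: (@choice _ _ (fun i (o : option (bool -> sortK N)) => oin A o /\
    (if omap (fun x b => fn (x b) w) o is Some x then x false else fn v w) = b
      i)) => i.
  have [_ [x [Ax|->] <-] <-] := hb i; first by exists (Some x).
  by exists None.
have e : b = oenv (oeval z w) (fn v w) false by apply: funext => i;
  rewrite (hz i).2.
have [k hk] := finite_lec fin.
have [|//|] := H (acl_event g p z k).
  right; exists g => //; exists m => //; exists p => //; exists k => //.
  by exists z => // i; exact: (hz i).1.
by case; rewrite -e.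
Qed.

End FreeStep.

(** * Types in the randomization determined by first order events *)

Lemma distK_muB (a b : sortK N) : distK a b =
  muB (evK (FNot (FEq (TVar L ord0) (TVar L (lift ord0 ord0))))
    (fcons a (fun _ : 'I_1 => b))).
Proof.
rewrite -{1}(hrep a) -{1}(hrep b) red_distK evK_rep red_mu /=.
by rewrite /event /= fcons0 fconsS.
Qed.

Definition same_events k (x x' : 'I_k -> sortK N) : Prop :=
  forall m (q : formula L m) (s : 'I_m -> 'I_k),
    evK q (fun i => x (s i)) = evK q (fun i => x' (s i)).

(** This is [free_step] with [G] empty, applied to the finitely many pairs of corresponding
    entries. *)
Lemma same_events_extend k (x x' : 'I_k -> sortK N) a : same_events x x' ->
  exists v, same_events (fcons a x) (fcons v x').
Proof.
move=> xx'; pose A := [set pair_fun (x i) (x' i) | i in [set: 'I_k]].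
have cA : countable A by apply: countable_image; exact: countableP.
have eA : elemN A.
  move=> m q z hz.
  have [s hs] : {s : 'I_m -> 'I_k & forall i,
    pair_fun (x (s i)) (x' (s i)) = z i}.
    apply: (@choice _ _ (fun i j => pair_fun (x j) (x' j) = z i)) => i.
    by have [j _ <-] := hz i; exists j.
  have -> : z = fun i => pair_fun (x (s i)) (x' (s i)) by exact: funext.
  exact: xx'.
have [v [ev _]] := free_step cA eA (@countable0 (Om -> M)) (@sub0set _ J) a.
exists v => m q s.
apply: (ev m q (fun i => pair_fun (fcons a x (s i)) (fcons v x' (s i)))) => i.
case: (unliftP ord0 (s i)) => [j|] ->; rewrite ?fcons0 ?fconsS; last by right.
by left; exists j.
Qed.

(* Back and forth: [same_events] is preserved by adding a random element on
   either side, while events are matched with themselves. *)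
Lemma ceval_same_events k e (p : cformula R L k e) x x' y :
  same_events x x' -> ceval p x y = ceval p x' y.
Proof.
have sym n (u u' : 'I_n -> sortK N) : same_events u u' -> same_events u' u.
  by move=> H m q s.
have bev k' e' (t : bterm L k' e') u u' y' :
    same_events u u' -> beval (N := N) u y' t = beval u' y' t.
  by move=> uu'; elim: t => //= [s -> t ->|s -> t ->|t ->].
elim: p x x' y => {k e} /= [k e i j|k e s t|k e t|k e n u ps IH|k e p IH|k e p
  IH|k e p IH|k e p IH] x x' y xx'.
- have := xx' 2%N (FNot (FEq (TVar L ord0) (TVar L (lift ord0 ord0))))
    (fcons i (fun _ : 'I_1 => j)).
  have E (z : 'I_k -> sortK N) : (fun l => z (fcons i (fun _ : 'I_1 => j) l)) =
      fcons (z i) (fun _ : 'I_1 => z j).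
    by apply: funext => l; rewrite (fcons_comp z).
  by rewrite !E !distK_muB => ->.
- by rewrite !(bev _ _ _ _ _ _ xx').
- by rewrite !(bev _ _ _ _ _ _ xx').
- by congr (u _); apply/rowP => l; rewrite !mxE; exact: IH.
- congr (sup _); apply/seteqP; split=> _ [a _ <-].
    have [v h] := same_events_extend a xx'; exists v => //.
    by apply/esym; exact: IH.
  have [v h] := same_events_extend a (sym _ _ _ xx'); exists v => //.
  by apply/esym; exact: IH.
- congr (inf _); apply/seteqP; split=> _ [a _ <-].
    have [v h] := same_events_extend a xx'; exists v => //.
    by apply/esym; exact: IH.
  have [v h] := same_events_extend a (sym _ _ _ xx'); exists v => //.
  by apply/esym; exact: IH.
- congr (sup _); apply/seteqP; split=> _ [b _ <-]; exists b => //; apply: IH =>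
  //.
- congr (inf _); apply/seteqP; split=> _ [b _ <-]; exists b => //; apply: IH =>
  //.
Qed.

(** * Iteration along a countable set, and free copies *)

Lemma acl_cover (B : set (sortK N)) : countable B ->
  exists G : set (Om -> M), [/\ countable G, G `<=` J &
    forall w, acl (pointwise fn B w) `<=` side w G].
Proof.
move=> cB; pose I := {n : nat & (formula L n.+1 * ('I_n -> sortK N))%type}.
have [g hg] : {g : I -> set (Om -> M) & forall c : I, [/\ countable (g c),
    g c `<=` J & forall w x,
      finite_set [set x | sat (projT2 c).1 (fcons x (fun i =>
        fn ((projT2 c).2 i) w))] ->
      sat (projT2 c).1 (fcons x (fun i => fn ((projT2 c).2 i) w)) ->
        side w (g c) x]}.
  apply: (@choice _ _ (fun (c : I) g => [/\ countable g,
    g `<=` J & forall w x,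
      finite_set [set x | sat (projT2 c).1 (fcons x (fun i =>
        fn ((projT2 c).2 i) w))] ->
      sat (projT2 c).1 (fcons x (fun i => fn ((projT2 c).2 i) w)) ->
        side w g x])).
  move=> [n [p b]] /=; apply: (enumerate_solutions HJ p (b := fun i =>
    fn (b i))) => i.
  exact: J_fn.
(* Countably many formulas and tuples from [B] each contribute the countable set that enumerates
   their finite solution sets. *)
exists (\bigcup_n \bigcup_(p in [set: formula L n.+1])
  \bigcup_(b in [set b : 'I_n -> sortK N | forall i,
    B (b i)]) g (existT _ n (p, b))).
split.
- apply: bigcup_countable => // n _.
  apply: bigcup_countable => [|p _]; first exact: countable_formula.
  apply: bigcup_countable => [|b _]; first exact: countable_tuples.
  by have [] := hg (existT _ n (p, b)).
- move=> h [n _ [p _ [b _]]]; have [_ gJ _] := hg (existT _ n (p, b));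
  exact: gJ.
move=> w y [n [p [b [hb fin sy]]]].
have [c hc] : {c : 'I_n -> sortK N & forall i, B (c i) /\ fn (c i) w = b i}.
  apply: (@choice _ _ (fun i x => B x /\ fn x w = b i)) => i.
  by have [x Bx <-] := hb i; exists x.
have e : b = fun i => fn (c i) w by apply: funext => i; rewrite (hc i).2.
rewrite e in fin sy.
have [_ _ /(_ w y fin sy) [h hh <-]] := hg (existT _ n (p, c)).
by exists h => //; exists n => //; exists p => //; exists c => // i;
  exact: (hc i).1.
Qed.

Lemma chain_tuple (X : Type) (Xs : nat -> set X) m (z : 'I_m -> X) :
  (forall k, Xs k `<=` Xs k.+1) -> (forall i, exists k, Xs k (z i)) ->
  exists k, forall i, Xs k (z i).
Proof.
move=> mono hz.
have le k l : (k <= l)%N -> Xs k `<=` Xs l.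
  elim: l => [|l IH]; first by rewrite leqn0 => /eqP ->.
  rewrite leq_eqVlt => /orP[/eqP -> //|]; rewrite ltnS => /IH h x /h;
    exact: mono.
have [k hk] := choice hz.
exists (\max_i k i)%N => i; apply: le (hk i); exact: leq_bigmax.
Qed.

Definition diag (C : set (sortK N)) : set (bool -> sortK N) :=
  [set pair_fun c c | c in C].

Lemma side_pw b (A : set (bool -> sortK N)) w :
  side b (pw A w) = pointwise fn (side b A) w.
Proof.
apply/seteqP; split=> [_ [_ [x Ax <-] <-]|_ [_ [x Ax <-] <-]].
  by exists (x b) => //; exists x.
by exists (fun b => fn (x b) w) => //; exists x.
Qed.

Lemma side_diag b (C : set (sortK N)) : side b (diag C) = C.
Proof.
apply/seteqP; split=> [_ [_ [c Cc <-] <-]|c Cc]; first by case: b.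
by exists (pair_fun c c); [exists c|case: b].
Qed.

(** The identity on [C] is extended one element of [A] at a time, and the union of the stages is
    taken. Since [G] covers the closure over [B] and [C], no stage adds an element of that closure
    to the closure of the second side. *)
Lemma free_realization (A B C : set (sortK N)) :
  countable A -> countable B -> countable C ->
  exists X, [/\ countable X, elemN X, diag C `<=` X,
    forall a, A a -> exists v, X (pair_fun a v) &
    ae P (fun w => acl (side false (pw X w)) `&` acl (pointwise fn (B `|` C) w)
      `<=` acl (pointwise fn C w))].
Proof.
move=> cA cB cC.
have [G [cG GJ hG]] := acl_cover (countableU cB cC).
have [v0 Jv0] := J_inhabited HJ.
pose x0 : sortK N := redK red (exist _ v0 Jv0).
have [f finj] := countable_injP _ cA.
(* [xs] enumerates [A] through the injection [f]; values at other indices only add further pairs. *)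
have [xs hxs] : {xs : nat -> sortK N & forall n a, A a -> f a = n -> xs n = a}.
  apply: (@choice _ _ (fun n x => forall a, A a -> f a = n -> x = a)) => n.
  case: (pselect (exists a, A a /\ f a = n)) => [[a [Aa fa]]|no].
    by exists a => a' Aa' fa'; apply: finj; rewrite ?inE // fa fa'.
  by exists x0 => a Aa fa; case: no; exists a.
pose goal (X : set (bool -> sortK N)) a v :=
  elemN (X `|` [set pair_fun a v]) /\
  ae P (fun w => forall g, G g ->
    acl (side false (pw (X `|` [set pair_fun a v]) w)) (g w) ->
    acl (side false (pw X w)) (g w)).
have [nx hnx] : {nx : set (bool -> sortK N) * sortK N -> sortK N & forall c,
    countable c.1 -> elemN c.1 -> goal c.1 c.2 (nx c)}.
  apply: (@choice _ _ (fun c v => countable c.1 -> elemN c.1 ->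
    goal c.1 c.2 v)).
  move=> [X a] /=; case: (pselect (countable X /\ elemN X)) => [[cX eX]|no].
    by have [v hv] := free_step cX eX cG GJ a; exists v.
  by exists x0 => cX eX; case: no.
pose fix Xs k := if k is k.+1
  then Xs k `|` [set pair_fun (xs k) (nx (Xs k, xs k))] else diag C.
have good k : countable (Xs k) /\ elemN (Xs k).
  elim: k => [|k [cX eX]] /=.
    split=> [|m q z hz]; first exact: countable_image.
    congr (evK q); apply: funext => i; by have [c _ <-] := hz i.
  split; last exact: (hnx (Xs k, xs k) cX eX).1.
  apply: countableU => //; exact: countable1.
have mono k : Xs k `<=` Xs k.+1 by move=> x; left.
exists (\bigcup_k Xs k); split.
- by apply: bigcup_countable => // k _; exact: (good k).1.
- move=> m q z hz; have [|k hk] := @chain_tuple _ Xs m z mono.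
    by move=> i; have [k _ h] := hz i; exists k.
  exact: (good k).2.
- by move=> x Cx; exists 0%N.
- move=> a Aa; exists (nx (Xs (f a), xs (f a))); exists (f a).+1 => //=.
  by right; rewrite (hxs (f a) a).
have : ae P (fun w => forall k g, G g ->
    acl (side false (pw (Xs k.+1) w)) (g w) ->
      acl (side false (pw (Xs k) w)) (g w)).
  by apply: ae_forall_nat => k; exact: (hnx (Xs k,
    xs k) (good k).1 (good k).2).2.
apply: aeS => w H y [[n [p [b [hb fin sy]]]] /hG[g Gg e]].
(* Algebraicity over the union uses finitely many parameters, hence holds over one stage [k]. It
   then descends to [diag C], whose second side is [C]. *)
have [||k hk] := @chain_tuple _ (fun k => side false (pw (Xs k) w)) n b.
- by move=> k x [_ [u Xu <-] <-]; exists (fun b => fn (u b) w) => //;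
  exists u => //; left.
- by move=> i; have [_ [u [k _ Xu] <-] <-] := hb i; exists k; exists (fun b =>
  fn (u b) w) => //; exists u.
have : acl (side false (pw (Xs k) w)) (g w) by rewrite e; exists n, p, b.
rewrite -e; elim: k {hk} => [|k IH] h; first by rewrite side_pw side_diag in h.
by apply: IH; exact: H.
Qed.

(** A finite tuple from [A] and [C] and its image consist of the two sides of pairs in [X], so
    [ceval_same_events] applies. *)
Lemma same_type_elemN (X : set (bool -> sortK N)) (C A : set (sortK N)) f :
  elemN X -> diag C `<=` X -> (forall a, A a -> X (pair_fun a (f a))) ->
  same_type_over C (f @` A) A.
Proof.
move=> eX CX AX; exists f => // m n p a c hA hC.
apply: ceval_same_events => l q s; apply/esym.
have := eX l q (fun i => pair_fun (fcat a c (s i)) (fcat (fun i =>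
  f (a i)) c (s i))).
apply=> i; rewrite /fcat; case: fintype.split => j; first exact: AX.
by apply: CX; exists (c j).
Qed.

(** The witness is [D = C], and monotonicity of [acl] passes to the subsets [A'] and [B']. *)
Lemma aomega_indep_acl (A B C : set (sortK N)) : countable C ->
  ae P (fun w => acl (pointwise fn A w `|` pointwise fn C w) `&`
    acl (pointwise fn B w `|` pointwise fn C w) `<=` acl (pointwise fn C w)) ->
  aomega_indep P fn A C B.
Proof.
move=> cC h A' B' C' _ _ _ AA BB CC; exists C; split=> //=.
apply: (ae_probability1 (neat_complete HJ)); apply: aeS h => w H.
apply/seteqP; split=> [y [yA yB]|y yC].
  by apply: H; split; [move: yA|move: yB]; apply: acl_mono;
    apply: setSU; apply: image_subset.
by split; apply: acl_mono yC; exact: subsetUr.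
Qed.

(** Taking [C' = C] in the definition forces [D = C]. *)
Lemma acl_aomega_indep (A B C : set (sortK N)) :
  countable A -> countable B -> countable C -> aomega_indep P fn A C B ->
  ae P (fun w => acl (pointwise fn A w `|` pointwise fn C w) `&`
    acl (pointwise fn B w `|` pointwise fn C w) `<=` acl (pointwise fn C w)).
Proof.
move=> cA cB cC /(_ A B C cA cB cC) [] // D [_ CD DC /= [mE PE]].
have eD : D = C by apply/seteqP; split.
rewrite eD in mE PE; apply: aeS (probability1_ae mE PE) => w /= -> //.
Qed.

(* The second clause is invariance of [aomega_indep] under partial elementary
   maps; it turns independence over [B `|` C] into independence over [C]. *)
Lemma free_copy (A B C : set (sortK N)) :
  countable A -> countable B -> countable C ->
  exists f, [/\ same_type_over C (f @` A) A, aomega_indep P fn (f @` A) C B &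
    forall Y Z, Y `<=` C -> Z `<=` C ->
      ae P (fun w => acl (pointwise fn A w `|` pointwise fn Z w) `&`
        acl (pointwise fn Y w `|` pointwise fn Z w) `<=` acl (pointwise fn Z
          w)) ->
      ae P (fun w => acl (pointwise fn (f @` A) w `|` pointwise fn Z w) `&`
        acl (pointwise fn Y w `|` pointwise fn Z w) `<=` acl (pointwise fn Z
          w))].
Proof.
move=> cA cB cC; have [X [cX eX CX AX hX]] := free_realization cA cB cC.
have [f hf] : {f : sortK N -> sortK N & forall a, A a -> X (pair_fun a (f a))}.
  apply: (@choice _ _ (fun a v => A a -> X (pair_fun a v))) => a.
  by case: (pselect (A a)) => [/AX[v hv]|na]; [exists v|exists a].
have fX : f @` A `<=` side false X.
  by move=> _ [a Aa <-]; exists (pair_fun a (f a)) => //; exact: hf.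
have CfX : C `<=` side false X.
  by move=> c Cc; exists (pair_fun c c) => //; apply: CX; exists c.
exists f; split.
- exact: same_type_elemN CX hf.
- apply: aomega_indep_acl => //; apply: aeS hX => w H y [yA yB]; apply: H;
  split.
    move: yA; apply: acl_mono; rewrite side_pw subUset.
    by split; apply: image_subset.
  by move: yB; rewrite /pointwise image_setU.
move=> Y Z YC ZC; move=> h; apply: aeS (aeI (elemN_ae cX eX) h) => w [ew H].
(* [V] is the graph of [f] on [A]. Applying [elem_acl_meet] to it replaces [A] by its image, while
   [Y] and [Z], entering through [diag], stay fixed. *)
pose V := [set pair_fun a (f a) | a in A].
have sV b : side b V = if b then A else f @` A.
  apply/seteqP; split=> [_ [_ [a Aa <-] <-]|x].
    by case: b => //; exists a.
  by case: b => [Ax|[a Aa <-]]; [exists (pair_fun x (f x))|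
    exists (pair_fun a (f a))] => //; [exists x|exists a].
have diagX S : S `<=` C -> diag S `<=` X.
  by move=> SC _ [c /SC Cc <-]; apply: CX; exists c.
have VX : V `<=` X by move=> _ [a Aa <-]; exact: hf.
have sU b S S' : side b (pw (S `|` S') w) =
    pointwise fn (side b S) w `|` pointwise fn (side b S') w.
  by rewrite side_pw /side /pointwise !image_setU.
have := @elem_acl_meet _ _ (pw X w) (pw (V `|` diag Z) w)
  (pw (diag Y `|` diag Z) w) (pw (diag Z) w) ew.
rewrite !sU !side_pw !side_diag !sV; apply=> //; apply: image_subset.
- by rewrite subUset; split=> //; exact: diagX.
- by rewrite subUset; split; exact: diagX.
- exact: diagX.
Qed.

End BigRandomization.

(** * Deduction of full existence and extension *)

Theorem theorem7p7 (U : Type) (hU : uncountable_inaccessible U)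
    (L : signature) (hL : countable_signature L)
    (T : set (sentence L)) (hT : complete_theory T)
    (hT1 : forall M : structure L, models M T -> exists x y : M, x <> y)
    (M : structure L) (hM : big_model U T M)
    (R : realType) (d : measure_display) (Om : measurableType d)
    (P : probability Om R) (J : set (Om -> M))
    (HJ : neat_randomization P J)
    (N : prestructure R L) (hN : big_model_of_randomization U T N)
    (red : reduction (randomization HJ) N)
    (rep : sortK N -> sortK (randomization HJ))
    (hrep : forall b, redK red (rep b) = b) :
  let indep := aomega_indep P (fun b => sval (rep b)) in
  (forall A B C : set (sortK N), countable A -> countable B -> countable C ->
     exists A', same_type_over C A' A /\ indep A' C B) /\
  (forall A B B' C : set (sortK N),
     countable A -> countable B -> countable B' -> countable C -> B `<=` B' ->
     indep A C B ->
     exists A', same_type_over (B `|` C) A' A /\ indep A' C B').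
Proof.
have [metN _ satN cardN] := hN.
have uncN : ~ countable [set: (sortK N + sortB N)%type].
  by rewrite (eq_countable cardN); exact: inacc_uncountable hU.
have copy := free_copy hrep metN satN uncN hL.
split=> [A B C cA cB cC|A B B' C cA cB cB' cC BB' indA].
  by have [f [tf indf _]] := copy A B C cA cB cC; exists (f @` A).
(* For extension, the copy is taken over [B] and [C] together and free from [B']. *)
have [f [tf indf inv]] := copy A B' (B `|` C) cA cB' (countableU cB cC).
exists (f @` A); split=> //.
have cfA : countable (f @` A) by exact: countable_image.
apply: aomega_indep_acl => //.
have hBC := acl_aomega_indep cfA cB' (countableU cB cC) indf.
(* The given independence of [A] from [B] over [C] passes to the image. *)
have hC := inv B C (@subsetUl _ _ _) (@subsetUr _ _ _)
  (acl_aomega_indep cA cB cC indA).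
apply: aeS (aeI hBC hC) => w [H H'] y [yA yB].
have BCw : pointwise (fn rep) (B `|` C) w =
    pointwise (fn rep) B w `|` pointwise (fn rep) C w.
  by rewrite /pointwise image_setU.
(* Transitivity: [y] is algebraic over [B] and [C] by [H], and then over [C] alone by [H']. *)
apply: H'; split=> //; rewrite -BCw; apply: H; split.
  by move: yA; apply: acl_mono; apply: setUS; rewrite BCw; exact: subsetUr.
by move: yB; apply: acl_mono; apply: setUS; rewrite BCw; exact: subsetUr.
Qed.
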